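(* Let $0<q<1$, let $n\ge 1$, let $a_1,\dots,a_n$ be non-negative integers, and put $|A|=a_1+\dots+a_n$, $b_i\in\{0,1\}$ with $b_i\equiv a_i \pmod 2$, and $B_j=\sum_{i<j}b_i$. Consider the formal power series $$H=e_{q^4}(-x_1^2)\,\tilde h_{a_1}(x_1;q^2)\,e_{q^4}(-x_2^2)\,\tilde h_{a_2}(x_2;q^2)\cdots e_{q^4}(-x_n^2)\,\tilde h_{a_n}(x_n;q^2)\in\mathcal A .$$ Then, for every $\gamma\in(\mathbb R\setminus\{0\})^n$, the realized braided Fourier transform of $H$ is $$F_S^{\gamma}(H)=\Big[\prod_{j=1}^n\int_{-q^{\,n-j+B_j}\gamma_j\cdot\infty}^{q^{\,n-j+B_j}\gamma_j\cdot\infty}e_{q^4}(-t^2)\,d_{q^2}t\Big]\,(-i)^{|A|}\,q^{\sum_k (a_k-a_k^2)}\ \prod_{j=1}^n\big(\partial_j^{a_j}\,E_{q^4}(-q^4\partial_j^2)\big)\in\mathcal D,$$ where the product of the elements $\partial_j^{a_j}E_{q^4}(-q^4\partial_j^2)$ is taken in increasing order of $j$ (factor $j=1$ leftmost).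
   Context: Algebras. $\mathcal A$ is the complex algebra of formal power series in $x_1,\dots,x_n$ with relations $x_ix_j=q\,x_jx_i$ for $i>j$; every element is uniquely $\sum_{e}c_e\,x_1^{e_1}\cdots x_n^{e_n}$. $\mathcal D$ is the complex algebra of formal power series in $\partial_1,\dots,\partial_n$ with relations $\partial_i\partial_j=q\,\partial_j\partial_i$ for $i<j$; every element is uniquely $\sum_e c_e\,\partial_n^{e_n}\cdots\partial_1^{e_1}$. Realization. For $f=\sum_e c_e x_1^{e_1}\cdots x_n^{e_n}\in\mathcal A$, $f_{\cdot 1}(z)=\sum_e c_e z_1^{e_1}\cdots z_n^{e_n}$ in commuting variables. $\Pi_0 f$ is the part of $f$ consisting of the terms with all $e_j$ even. $q$-notation. $(a;p)_k=\prod_{l=0}^{k-1}(1-ap^l)$; $e_p(z)=\sum_{k\ge0}z^k/(p;p)_k$ (analytically continued as $1/(z;p)_\infty$ when evaluated numerically); $E_p(z)=\sum_{k\ge0}p^{k(k-1)/2}z^k/(p;p)_k$; discrete $q^2$-Hermite II polynomials $$\tilde h_l(z;q^2)=(q^2;q^2)_l\sum_{k=0}^{\lfloor l/2\rfloor}\frac{(-1)^kq^{-4kl+2k(2k+1)}z^{l-2k}}{(q^4;q^4)_k\,(q^2;q^2)_{l-2k}} .$$ Jackson integral: $\int_{-c\cdot\infty}^{c\cdot\infty}\varphi(t)\,d_{q^2}t=(1-q^2)\sum_{k\in\mathbb Z}\sum_{\varepsilon=\pm1}q^{2k}c\,\varphi(\varepsilon q^{2k}c)$; multiple Jackson integrals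 are iterated. Integral. If $(\Pi_0 g)_{\cdot1}$ converges absolutely near $0$, continues analytically to $\mathbb R^n+iU$ for an open neighbourhood $U$ of $0$ in $\mathbb R^n$, and is absolutely $q^2$-Jackson integrable over every lattice with non-zero coordinates, then $g$ is called $I'$-integrable and $$(I'g)_{\cdot1}(\gamma)=\int_{-q^{n-1}\gamma_1\cdot\infty}^{q^{n-1}\gamma_1\cdot\infty}\cdots\int_{-q^{n-j}\gamma_j\cdot\infty}^{q^{n-j}\gamma_j\cdot\infty}\cdots\int_{-\gamma_n\cdot\infty}^{\gamma_n\cdot\infty}(\Pi_0g)_{\cdot1}(t)\,d_{q^2}t_n\cdots d_{q^2}t_1 .$$ Transform. If $f\,x_1^{e_1}\cdots x_n^{e_n}$ is $I'$-integrable for all $e\in\mathbb Z_{\ge0}^n$, then, with $|E|=\sum_j e_j$, $$F_S^\gamma(f)=\sum_{e\in\mathbb Z_{\ge0}^n}\big(I'(f\,x_1^{e_1}\cdots x_n^{e_n})\big)_{\cdot1}(\gamma)\ \frac{(-i)^{|E|}\,q^{|E|^2+|E|+\sum_j(n-j)e_j}}{\prod_j(q^2;q^2)_{e_j}}\ \partial_n^{e_n}\cdots\partial_1^{e_1}\in\mathcal D .$$ (By definition two transforms are equal iff their values agree for all $\gamma$.) *)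

(* Defs.v *)
From HB Require Import structures.
From mathcomp Require Import all_boot all_order all_algebra.
From mathcomp Require Import complex.
From mathcomp Require Import all_classical all_reals all_analysis.

Set Implicit Arguments.
Unset Strict Implicit.
Unset Printing Implicit Defensive.

Import Order.TTheory GRing.Theory Num.Theory.
Import numFieldNormedType.Exports.

Local Open Scope classical_set_scope.
Local Open Scope ring_scope.
Local Open Scope complex_scope.

(* Indices are 0-based: [i : 'I_n] stands for the subscript j = i + 1, so that *)
(* n - j is [n - i.+1].                                                        *)

Section Sums.
Variables (R : realType) (I : choiceType).

Definition abs_summable (u : I -> R[i]) : Prop :=
  summable [set: I] (fun i => (Normc.normc (u i))%:E).

Definition rsum (u : I -> R) : R :=
  fine (\esum_(i in [set: I]) (Num.max (u i) 0)%:E) -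
  fine (\esum_(i in [set: I]) (Num.max (- u i) 0)%:E).

(* The sum of [u]; meaningful when [abs_summable u]. *)
Definition csum (u : I -> R[i]) : R[i] :=
  rsum (fun i => complex.Re (u i)) +i* rsum (fun i => complex.Im (u i)).

End Sums.

Section MultiIndex.
Variable n : nat.

Definition mindex := {ffun 'I_n -> nat}.
Definition mindex0 : mindex := [ffun=> 0%N].
Definition munit (i : 'I_n) : mindex := [ffun j => (j == i : nat)].
Definition madd (d e : mindex) : mindex := [ffun i => (d i + e i)%N].
Definition msub (e d : mindex) : mindex := [ffun i => (e i - d i)%N].
Definition mdeg (e : mindex) : nat := (\sum_i e i)%N.

(* All d with d <= e componentwise. *)
Definition mbelow (e : mindex) : seq mindex :=
  [seq [ffun i => val (d i)] | d : {ffun 'I_n -> 'I_(mdeg e).+1} in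
    [pred d : {ffun 'I_n -> 'I_(mdeg e).+1} | [forall i, (d i <= e i)%N]]].

End MultiIndex.

Section Algebras.
Variables (R : realType) (q : R) (n : nat).

(* [f : algA] is the series \sum_e f(e) x_1^{e_1} ... x_n^{e_n}. *)
Definition algA := mindex n -> R[i].

(* [f : algD] is the series \sum_e f(e) d_n^{e_n} ... d_1^{e_1}. *)
Definition algD := mindex n -> R[i].

Definition monoA (d : mindex n) : algA := fun e => (e == d)%:R.
Definition monoD (d : mindex n) : algD := fun e => (e == d)%:R.

(* Normal ordering with x_i x_j = q x_j x_i for i > j gives                    *)
(* x^d x^e = q^{\sum_{i > j} d_i e_j} x^{d+e}; see [qmulA_mono], [qmulA_gen].    *)
Definition qmulA (f g : algA) : algA := fun e =>
  \sum_(d <- mbelow e)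
    f d * g (msub e d) *
    (q ^+ (\sum_(i < n) \sum_(j < n | (j < i)%N) d i * msub e d j)%N)%:C.

(* Likewise with d_i d_j = q d_j d_i for i < j, for the opposite ordering of   *)
(* the monomials; see [qmulD_mono], [qmulD_gen].                                 *)
Definition qmulD (f g : algD) : algD := fun e =>
  \sum_(d <- mbelow e)
    f d * g (msub e d) *
    (q ^+ (\sum_(i < n) \sum_(j < n | (i < j)%N) d i * msub e d j)%N)%:C.

Definition scaleA (c : R[i]) (f : algA) : algA := fun e => c * f e.
Definition scaleD (c : R[i]) (f : algD) : algD := fun e => c * f e.

(* \sum_k c_k x_i^k and \sum_k c_k d_i^k for real coefficients c_k. *)
Definition uniseriesA (i : 'I_n) (c : nat -> R) : algA := fun e =>
  if [forall j, (j != i) ==> (e j == 0%N)] then (c (e i))%:C else 0.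
Definition uniseriesD (i : 'I_n) (c : nat -> R) : algD := fun e =>
  if [forall j, (j != i) ==> (e j == 0%N)] then (c (e i))%:C else 0.

Definition Pi0 (f : algA) : algA := fun e =>
  if [forall j, ~~ odd (e j)] then f e else 0.

End Algebras.

Section AlgebraSanity.
Variables (R : realType) (q : R) (n : nat).

Lemma mbelow_uniq (e : mindex n) : uniq (mbelow e).
Proof.
rewrite /mbelow map_inj_uniq ?enum_uniq// => d d' /ffunP h.
by apply/ffunP => i; apply: val_inj; have := h i; rewrite !ffunE.
Qed.

Lemma mem_mbelow (d e : mindex n) :
  (d \in mbelow e) = [forall i, (d i <= e i)%N].
Proof.
apply/idP/idP => [/mapP[d' + ->]|/forallP h].
  rewrite mem_enum => /forallP h; apply/forallP => i.
  by rewrite ffunE; exact: h.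
have hd i : (d i < (mdeg e).+1)%N.
  rewrite ltnS; apply: leq_trans (h i) _.
  by rewrite /mdeg (bigD1 i)//= leq_addr.
apply/mapP; exists [ffun i => Ordinal (hd i)].
  by rewrite mem_enum; apply/forallP => i; rewrite ffunE; exact: h.
by apply/ffunP => i; rewrite !ffunE.
Qed.

Let conv_mono (w : mindex n -> mindex n -> R[i]) (a b e : mindex n) :
  \sum_(d <- mbelow e) (d == a)%:R * (msub e d == b)%:R * w d (msub e d)
  = w a b * (e == madd a b)%:R.
Proof.
have [->|neq] := eqVneq e (madd a b).
  have ain : a \in mbelow (madd a b).
    by rewrite mem_mbelow; apply/forallP => i; rewrite ffunE leq_addr.
  have E : msub (madd a b) a = b.
    by apply/ffunP => i; rewrite !ffunE addKn.
  rewrite (bigD1_seq a)//= ?mbelow_uniq// eqxx E eqxx big1 ?addr0 ?mulr1 ?mul1r//.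
  by move=> d /negbTE->; rewrite !mul0r.
rewrite mulr0 big_seq big1// => d; rewrite mem_mbelow => /forallP h.
have [da|] := eqVneq d a; last by rewrite !mul0r.
have [sb|] := eqVneq (msub e d) b; last by rewrite mulr0 mul0r.
case/eqP: neq; apply/ffunP => i.
by rewrite ffunE -da -sb ffunE subnKC.
Qed.

Lemma qmulA_mono (a b : mindex n) :
  qmulA q (monoA R a) (monoA R b) =
  scaleA (q ^+ (\sum_(i < n) \sum_(j < n | (j < i)%N) a i * b j)%N)%:C
    (monoA R (madd a b)).
Proof.
apply/funext => e; rewrite /qmulA /scaleA /monoA.
by rewrite -(conv_mono (fun a b =>
  (q ^+ (\sum_(i < n) \sum_(j < n | (j < i)%N) a i * b j)%N)%:C)).
Qed.

Lemma qmulD_mono (a b : mindex n) :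
  qmulD q (monoD R a) (monoD R b) =
  scaleD (q ^+ (\sum_(i < n) \sum_(j < n | (i < j)%N) a i * b j)%N)%:C
    (monoD R (madd a b)).
Proof.
apply/funext => e; rewrite /qmulD /scaleD /monoD.
by rewrite -(conv_mono (fun a b =>
  (q ^+ (\sum_(i < n) \sum_(j < n | (i < j)%N) a i * b j)%N)%:C)).
Qed.

Let sum_munit (r : rel nat) (i j : 'I_n) :
  (\sum_(k < n) \sum_(l < n | r k l) munit i k * munit j l = r i j)%N.
Proof.
rewrite (bigD1 i)//= [X in (_ + X)%N]big1 => [|k /negbTE ki].
  rewrite addn0 big_mkcond (bigD1 j)//= big1 => [|l /negbTE lj].
    by rewrite !ffunE !eqxx addn0; case: ifP.
  by rewrite !ffunE lj muln0; case: ifP.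
by rewrite big1// => l _; rewrite ffunE ki.
Qed.

Let maddC (d e : mindex n) : madd d e = madd e d.
Proof. by apply/ffunP => i; rewrite !ffunE addnC. Qed.

Lemma qmulA_gen (i j : 'I_n) : (j < i)%N ->
  qmulA q (monoA R (munit i)) (monoA R (munit j)) =
  scaleA q%:C (qmulA q (monoA R (munit j)) (monoA R (munit i))).
Proof.
move=> ji; rewrite !qmulA_mono (sum_munit (fun k l => l < k)%N).
rewrite (sum_munit (fun k l => l < k)%N) ji (ltnNge i) (ltnW ji) /=.
by rewrite expr1 expr0 maddC; apply/funext => e; rewrite /scaleA mul1r.
Qed.

Lemma qmulD_gen (i j : 'I_n) : (i < j)%N ->
  qmulD q (monoD R (munit i)) (monoD R (munit j)) =
  scaleD q%:C (qmulD q (monoD R (munit j)) (monoD R (munit i))).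
Proof.
move=> ij; rewrite !qmulD_mono (sum_munit (fun k l => k < l)%N).
rewrite (sum_munit (fun k l => k < l)%N) ij (ltnNge j) (ltnW ij) /=.
by rewrite expr1 expr0 maddC; apply/funext => e; rewrite /scaleD mul1r.
Qed.

End AlgebraSanity.

Section QNotation.
Variable R : realType.

Definition qpoch (a p : R) (k : nat) : R := \prod_(l < k) (1 - a * p ^+ l).

Definition qpoch_inf (a p : R) : R := lim (qpoch a p k @[k --> \oo]).

(* Coefficients of the formal series e_p and E_p. *)
Definition eq_coef (p : R) (k : nat) : R := (qpoch p p k)^-1.
Definition Eq_coef (p : R) (k : nat) : R := p ^+ 'C(k, 2) / qpoch p p k.

(* Numerical value of the continued e_p. *)
Definition eq_val (p z : R) : R := (qpoch_inf z p)^-1.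

(* Coefficients in y of the formal series \sum_k c_k (s y^2)^k. *)
Definition subst_sq (s : R) (c : nat -> R) (m : nat) : R :=
  if odd m then 0 else c m./2 * s ^+ m./2.

(* The discrete q^2-Hermite II polynomial \tilde h_l(X; q^2). *)
Definition hermiteII (q : R) (l : nat) : {poly R} :=
  qpoch (q ^+ 2) (q ^+ 2) l *:
  \sum_(k < l./2.+1)
    ((-1) ^+ k * q ^ (- (4 * k * l)%:Z + (2 * k * (2 * k + 1))%:Z) /
     (qpoch (q ^+ 4) (q ^+ 4) k * qpoch (q ^+ 2) (q ^+ 2) (l - 2 * k)))
    *: 'X^(l - 2 * k).

End QNotation.

Section Jackson.
Variables (R : realType) (q : R).

Definition sgnb (b : bool) : R := if b then 1 else -1.

Definition jackson (c : R) (phi : R -> R[i]) : R[i] :=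
  (1 - q ^+ 2)%:C *
  csum (fun k : int =>
    \sum_(b : bool) (q ^ (2 * k) * c)%:C * phi (sgnb b * q ^ (2 * k) * c)).

(* Iterated integral; the first coordinate is the outermost variable. *)
Fixpoint jacksonn (n : nat) : 'rV[R]_n -> ('rV[R]_n -> R[i]) -> R[i] :=
  match n with
  | 0 => fun _ phi => phi 0
  | m.+1 => fun (c : 'rV[R]_(1 + m)) (phi : 'rV[R]_(1 + m) -> R[i]) =>
      jackson (c 0 0) (fun t =>
        jacksonn (rsubmx c) (fun s : 'rV[R]_m => phi (row_mx t%:M s)))
  end.

Definition abs_jackson_integrable (n : nat) (c : 'rV[R]_n)
    (phi : 'rV[R]_n -> R[i]) : Prop :=
  abs_summable (fun ke : {ffun 'I_n -> int * bool} =>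
    (\prod_j (q ^ (2 * (ke j).1) * c 0 j))%:C *
    phi (\row_j (sgnb (ke j).2 * q ^ (2 * (ke j).1) * c 0 j))).

End Jackson.

Section Analytic.
Variables (R : realType) (n : nat).

Definition monomial (e : mindex n) (z : 'rV[R[i]]_n) : R[i] :=
  \prod_j z 0 j ^+ e j.

Definition polydisc (p : 'rV[R[i]]_n) (r : R) : set 'rV[R[i]]_n :=
  [set z | forall j, Normc.normc (z 0 j - p 0 j) < r].

Definition power_series_at (c : mindex n -> R[i]) (p : 'rV[R[i]]_n) (r : R)
    (F : 'rV[R[i]]_n -> R[i]) : Prop :=
  forall z, polydisc p r z ->
    abs_summable (fun e => c e * monomial e (z - p)) /\
    F z = csum (fun e => c e * monomial e (z - p)).

Definition analytic_on (D : set 'rV[R[i]]_n) (F : 'rV[R[i]]_n -> R[i]) : Prop :=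
  forall p, D p -> exists c r, 0 < r /\ power_series_at c p r F.

(* R^n + i U *)
Definition tube (U : set 'rV[R]_n) : set 'rV[R[i]]_n :=
  [set z | U (\row_j complex.Im (z 0 j))].

(* [F] analytically continues the commutative series \sum_e f(e) z^e, which    *)
(* converges absolutely near 0, to some R^n + i U.                             *)
Definition continuation (f : mindex n -> R[i]) (F : 'rV[R[i]]_n -> R[i]) : Prop :=
  (exists r, 0 < r /\ power_series_at f 0 r F) /\
  exists U : set 'rV[R]_n, [/\ open U, U 0 & analytic_on (tube U) F].

Definition on_reals (F : 'rV[R[i]]_n -> R[i]) (t : 'rV[R]_n) : R[i] :=
  F (\row_j (t 0 j)%:C).

End Analytic.

Section Transform.
Variables (R : realType) (q : R) (n : nat).

Definition integrable' (g : algA R n) : Prop :=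
  exists F, continuation (Pi0 g) F /\
    forall c : 'rV[R]_n, (forall j, c 0 j != 0) ->
      abs_jackson_integrable q c (on_reals F).

(* (I' g)_{.1}(gamma); continuations agree on R^n, so the choice of the        *)
(* continuation is immaterial.                                                 *)
Definition integral' (g : algA R n) (gamma : 'rV[R]_n) : R[i] :=
  jacksonn q (\row_j (q ^+ (n - j.+1) * gamma 0 j))
    (on_reals (xget (fun=> 0) [set F | continuation (Pi0 g) F])).

Definition transformable (f : algA R n) : Prop :=
  forall e : mindex n, integrable' (qmulA q f (monoA R e)).

Definition FS (gamma : 'rV[R]_n) (f : algA R n) : algD R n := fun e =>
  integral' (qmulA q f (monoA R e)) gamma *
  ((- 'i%C) ^+ mdeg e *
   (q ^+ (mdeg e ^ 2 + mdeg e + \sum_(j < n) (n - j.+1) * e j)%N /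
    \prod_j qpoch (q ^+ 2) (q ^+ 2) (e j))%:C).

Definition Hseries (a : 'I_n -> nat) : algA R n :=
  \big[@qmulA R q n/monoA R (mindex0 n)]_(j < n)
    qmulA q (uniseriesA j (subst_sq (-1) (eq_coef (q ^+ 4))))
           (uniseriesA j (fun m => (hermiteII q (a j))`_m)).

End Transform.

(* Main.v *)
Require Import Defs.
From HB Require Import structures.
From mathcomp Require Import all_boot all_order all_algebra.
From mathcomp Require Import complex.
From mathcomp Require Import all_classical all_reals all_analysis.
From mathcomp Require Import ring lra zify.

Set Implicit Arguments.
Unset Strict Implicit.
Unset Printing Implicit Defensive.

Import Order.TTheory GRing.Theory Num.Theory.
Import numFieldNormedType.Exports.

Local Open Scope classical_set_scope.
Local Open Scope ring_scope.
Local Open Scope complex_scope.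

(* Normal ordering realizes H x^e as the product over j of
   t^{e_j} phi_j(q^{E_j} t), where E_j = \sum_{i < j} e_i and
   phi_j(s) = w(s) h_{a_j}(s) with w(s) = e_{q^4}(-s^2). Pi0 kills it unless
   e = a mod 2. Otherwise the integral splits into one-variable Jackson integrals
   of s^e w(s) h_a(s). These do not change when the lattice parameter is
   multiplied by q^2, so only E_j modulo 2 matters, and E_j = B_j mod 2.

   The functional equation w(q^2 s) = (1 + s^2) w(s) gives
   m_{k+2} = (q^{-2k-2} - 1) m_k for the moments of w, and the three-term
   recurrence of the Hermite polynomials then gives, with p = q^2 and e = a mod 2,
   \int s^e w h_a = m_0 p^{-(a+k)^2} (p;p)_e / (p^2;p^2)_k if e = a + 2k and 0
   if e < a. These are the coefficients of the right-hand side.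

   The continuation of w comes from the same functional equation:
   w(z) = w(q^{2N} z) / \prod_{l < N} (1 + q^{4l} z^2), where w(q^{2N} z) is given
   by the power series as soon as |q^{2N} z| < 1, and all poles have |Im z| >= 1.
   Two continuations agree on real points by the identity theorem along the
   segments t x, 0 <= t <= 1. *)

(** The integral is taken of an arbitrarily chosen continuation, so its values at real points must
    be shown independent of the choice before anything can be computed. The weight occurs as a
    formal series, as a continued function and as a numerical infinite product; convergence of the
    product is itself derived from the series. The power of q in the transform has to be used up
    exactly: |E|^2 + |E| + \sum_j (n-j) e_j splits into \sum_j (e_j^2 + e_j), which completes the
    one-variable moments, \sum_j E_j (e_j + 1), which cancels the Jacobian and the rescaling caused
    by the arguments q^{E_j} t, and \sum_{i<j} e_i e_j, the price of bringing the product of the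
    powers of the d_j, in increasing order of j, into the normal order of [algD]. All rearrangements
    of infinite sums (Fubini, Cauchy products, re-expansion at another centre, grouping by degree)
    are summations over the fibres of a map and rest on absolute summability alone. *)

Section ComplexModulus.
Variable R : realType.
Implicit Types (z w : R[i]) (x : R).
Local Notation normc := (@Normc.normc R).

Lemma normc_ge0 z : 0 <= normc z.
Proof. by case: z => a b; exact: sqrtr_ge0. Qed.

Lemma normc_real x : normc x%:C = `|x|.
Proof. by rewrite /= expr0n addr0 sqrtr_sqr. Qed.

Lemma normcX z k : normc (z ^+ k) = normc z ^+ k.
Proof.
elim: k => [|k IH]; first by rewrite !expr0 Normc.normc1.
by rewrite !exprS Normc.normcM IH.
Qed.

Lemma normc_Re z : `|complex.Re z| <= normc z.
Proof.
case: z => a b; rewrite /= -sqrtr_sqr ler_wsqrtr// lerDl; exact: sqr_ge0.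
Qed.

Lemma normc_Im z : `|complex.Im z| <= normc z.
Proof.
case: z => a b; rewrite /= -sqrtr_sqr ler_wsqrtr// lerDr; exact: sqr_ge0.
Qed.

Lemma normc_leD z : normc z <= `|complex.Re z| + `|complex.Im z|.
Proof.
case: z => a b /=; rewrite -[leRHS]ger0_norm ?addr_ge0// -sqrtr_sqr ler_wsqrtr//.
rewrite sqrrD !real_normK ?num_real//.
have : 0 <= `|a| * `|b| by rewrite mulr_ge0.
by move: (`|a| * `|b|) => y; lra.
Qed.

End ComplexModulus.

(** * Unordered sums *)

Section NonnegativeSums.
Variable R : realType.

Definition psum (I : choiceType) (a : I -> R) : \bar R :=
  \esum_(i in [set: I]) (a i)%:E.
Definition psummable (I : choiceType) (a : I -> R) : Prop := (psum a < +oo)%E.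

Variables I K : choiceType.
Implicit Types (a b : I -> R).

Lemma psum_ge0 a : (forall i, 0 <= a i) -> (0 <= psum a)%E.
Proof. by move=> a0; apply: esum_ge0 => i _; rewrite lee_fin. Qed.

Lemma le_psum a b : (forall i, a i <= b i) -> (psum a <= psum b)%E.
Proof. by move=> ab; apply: le_esum => i _; rewrite lee_fin. Qed.

Lemma eq_psum a b : a =1 b -> psum a = psum b.
Proof. by move=> /funext ->. Qed.

Lemma psumD a b : (forall i, 0 <= a i) -> (forall i, 0 <= b i) ->
  psum (fun i => a i + b i) = (psum a + psum b)%E.
Proof.
by move=> a0 b0; rewrite /psum -esumD// => i _; rewrite lee_fin.
Qed.

Lemma psum_fine a : (forall i, 0 <= a i) -> psummable a ->
  (fine (psum a))%:E = psum a.
Proof. by move=> a0 aoo; rewrite fineK// ge0_fin_numE ?psum_ge0. Qed.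

Lemma psum_fin_num a : (forall i, 0 <= a i) -> psummable a -> psum a \is a fin_num.
Proof. by move=> a0 aoo; rewrite ge0_fin_numE ?psum_ge0. Qed.

Lemma fine_psum_ge0 a : (forall i, 0 <= a i) -> 0 <= fine (psum a).
Proof. by move=> a0; rewrite fine_ge0// psum_ge0. Qed.

Lemma le_fine_psum a b : (forall i, 0 <= a i) -> (forall i, a i <= b i) ->
  psummable b -> fine (psum a) <= fine (psum b).
Proof.
move=> a0 ab boo; have b0 i : 0 <= b i by exact: le_trans (ab i).
rewrite -lee_fin !psum_fine ?le_psum//.
by apply: le_lt_trans boo; exact: le_psum.
Qed.

Lemma psum_scale (c : R) a : 0 <= c -> (forall i, 0 <= a i) ->
  psum (fun i => c * a i) = (c%:E * psum a)%E.
Proof.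
move=> c0 a0; rewrite /psum /esum -ereal_supZl//; last first.
  by apply/set0P; exists 0%E; exists set0; rewrite ?fsbig_set0//; exact: fsets_set0.
congr ereal_sup; apply/seteqP; split => [x [A fA <-]|x [y [A fA <-]] <-].
  exists (\sum_(i \in A) (a i)%:E)%E; first by exists A.
  rewrite ge0_mule_fsumr// => *; by rewrite lee_fin.
exists A => //; rewrite ge0_mule_fsumr// => *; by rewrite lee_fin.
Qed.

Lemma psummable_le a b : (forall i, a i <= b i) -> psummable b -> psummable a.
Proof. by move=> ab; apply: le_lt_trans; exact: le_psum. Qed.

Lemma psummableD a b : (forall i, 0 <= a i) -> (forall i, 0 <= b i) ->
  psummable a -> psummable b -> psummable (fun i => a i + b i).
Proof. by move=> a0 b0 ha hb; rewrite /psummable psumD// lte_add_pinfty. Qed.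

Lemma psummableZ (c : R) a : 0 <= c -> (forall i, 0 <= a i) ->
  psummable a -> psummable (fun i => c * a i).
Proof.
by move=> c0 a0 ha; rewrite /psummable psum_scale// lte_mul_pinfty ?lee_fin.
Qed.

(** [I] is the disjoint union of the fibres of [f], so Tonelli for [\esum] applies. Each
    rearrangement below amounts to a choice of [f]. *)
Lemma psum_fiber (f : I -> K) a : (forall i, 0 <= a i) ->
  psum a = \esum_(k in [set: K]) psum (fun i => if f i == k then a i else 0).
Proof.
move=> a0; transitivity (\esum_(k in [set: K]) \esum_(i in [set i | f i = k]) (a i)%:E).
  rewrite (@esum_esum _ _ _ _ _ (fun _ i => (a i)%:E)); last first.
    by move=> *; rewrite lee_fin.
  rewrite (reindex_esum [set: I] _ (fun i => (f i, i)))//; split => //=.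
  - by move=> i j _ _ [].
  - by move=> [k i] [_ /= <-]; exists i.
apply: eq_esum => k _; rewrite esum_mkcond; apply: eq_esum => i _.
have [e|ne] := eqVneq (f i) k; first by rewrite mem_set.
by rewrite memNset// => /= e; rewrite e eqxx in ne.
Qed.

Lemma psum_fiber_fine (f : I -> K) a : (forall i, 0 <= a i) -> psummable a ->
  psum (fun k => fine (psum (fun i => if f i == k then a i else 0))) = psum a.
Proof.
move=> a0 aoo; rewrite [RHS](psum_fiber f)//; apply: eq_esum => k _.
rewrite psum_fine// => [i|]; first by case: ifP.
by apply: le_lt_trans aoo; apply: le_psum => i; case: ifP.
Qed.

Lemma psum_delta (i0 : I) (x : R) : 0 <= x ->
  psum (fun i => if i == i0 then x else 0) = x%:E.
Proof.
move=> x0; rewrite -(@esum_set1 _ _ i0 (fun=> x%:E)) ?lee_fin//.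
rewrite [RHS]esum_mkcond; apply: eq_esum => i _; rewrite in_set1.
by case: eqP.
Qed.

End NonnegativeSums.

Section RealSums.
Variable R : realType.
Implicit Types (I K : choiceType).

Definition rsummable (J : choiceType) (u : J -> R) := psummable (fun i => `|u i|).

(** [rsum] is built from positive and negative parts, which are not additive. Any other splitting
    [a - b] into summable non-negative families gives the same value, because u^+ + b = a + u^-
    termwise; additivity of [rsum] then needs no discussion of signs. *)
Lemma rsum_diff I (u : I -> R) (a b : I -> R) : (forall i, 0 <= a i) -> (forall i, 0 <= b i) ->
  psummable a -> psummable b -> (forall i, u i = a i - b i) ->
  rsum u = fine (psum a) - fine (psum b).
Proof.
move=> a0 b0 aoo boo uE; rewrite /rsum -!/(psum _).
set p := fun i => Num.max (u i) 0; set m := fun i => Num.max (- u i) 0.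
have p0 i : 0 <= p i by rewrite le_max lexx orbT.
have m0 i : 0 <= m i by rewrite le_max lexx orbT.
have pa i : p i <= a i by rewrite ge_max a0 uE lerBlDr lerDl b0.
have mb i : m i <= b i by rewrite ge_max b0 uE opprB lerBlDr lerDl a0.
have poo : psummable p by apply: le_lt_trans (le_psum pa) aoo.
have moo : psummable m by apply: le_lt_trans (le_psum mb) boo.
have E : (psum p + psum b = psum a + psum m)%E.
  rewrite -!psumD//; apply: eq_psum => i; rewrite /p /m uE.
  have /orP[le|le] := le_total 0 (a i - b i).
    by rewrite max_l// max_r ?oppr_le0// addr0 subrK.
  by rewrite max_r// max_l ?oppr_ge0// add0r opprB addrC subrK.
rewrite -(psum_fine p0)// -(psum_fine b0)// -(psum_fine a0)// -(psum_fine m0)// in E.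
move: E => []; lra.
Qed.

Lemma rsummable_pos I (u : I -> R) : rsummable u -> psummable (fun i => Num.max (u i) 0).
Proof.
move=> h; apply: le_lt_trans h; apply: le_psum => i.
by rewrite ge_max normr_ge0 ler_norm.
Qed.

Lemma rsummable_neg I (u : I -> R) : rsummable u -> psummable (fun i => Num.max (- u i) 0).
Proof.
move=> h; apply: le_lt_trans h; apply: le_psum => i.
by rewrite ge_max normr_ge0 -normrN ler_norm.
Qed.

Lemma max0_ge0 (x : R) : 0 <= Num.max x 0.
Proof. by rewrite le_max lexx orbT. Qed.

Lemma maxBmaxN (x : R) : Num.max x 0 - Num.max (- x) 0 = x.
Proof.
have /orP[le|le] := le_total 0 x.
  by rewrite max_l// max_r ?oppr_le0// subr0.
by rewrite max_r// max_l ?oppr_ge0// sub0r opprK.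
Qed.

Lemma rsummableZ I (c : R) (u : I -> R) : rsummable u -> rsummable (fun i => c * u i).
Proof.
move=> hu; rewrite /rsummable.
have -> : (fun i => `|c * u i|) = (fun i => `|c| * `|u i|).
  by apply/funext => i; rewrite normrM.
exact: psummableZ.
Qed.

Lemma rsumD I (u v : I -> R) : rsummable u -> rsummable v ->
  rsum (fun i => u i + v i) = rsum u + rsum v.
Proof.
move=> hu hv; pose P w (i : I) : R := Num.max (w i) 0; pose N w (i : I) : R := Num.max (- w i) 0.
have p0 w i : 0 <= P w i by exact: max0_ge0.
have n0 w i : 0 <= N w i by exact: max0_ge0.
rewrite (@rsum_diff _ _ (fun i => P u i + P v i) (fun i => N u i + N v i)); last first.
- by move=> i; rewrite -[in LHS](maxBmaxN (u i)) -[in LHS](maxBmaxN (v i)) /P /N; ring.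
- by apply: psummableD => //; exact: rsummable_neg.
- by apply: psummableD => //; exact: rsummable_pos.
- by move=> i; rewrite addr_ge0.
- by move=> i; rewrite addr_ge0.
rewrite !psumD// !fineD; try by apply: psum_fin_num => //;
  solve [exact: rsummable_pos|exact: rsummable_neg].
by rewrite /rsum /psum /P /N; ring.
Qed.

Lemma rsumN I (u : I -> R) : rsum (fun i => - u i) = - rsum u.
Proof.
rewrite /rsum opprB; congr (fine _ - fine _).
by apply: eq_esum => i _; rewrite opprK.
Qed.

Lemma rsumZ_ge0 I (c : R) (u : I -> R) : 0 <= c -> rsummable u ->
  rsum (fun i => c * u i) = c * rsum u.
Proof.
move=> c0 hu; rewrite (@rsum_diff _ _ (fun i => c * Num.max (u i) 0)
    (fun i => c * Num.max (- u i) 0)); last first.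
- by move=> i; rewrite -mulrBr maxBmaxN.
- by apply: psummableZ => // [i|]; [exact: max0_ge0|exact: rsummable_neg].
- by apply: psummableZ => // [i|]; [exact: max0_ge0|exact: rsummable_pos].
- by move=> i; rewrite mulr_ge0 ?max0_ge0.
- by move=> i; rewrite mulr_ge0 ?max0_ge0.
rewrite !psum_scale//; do ?by move=> i; exact: max0_ge0.
rewrite !fineM//; try by apply: psum_fin_num => // [i|];
  solve [exact: max0_ge0|exact: rsummable_pos|exact: rsummable_neg].
by rewrite -mulrBr.
Qed.

Lemma rsumZ I (c : R) (u : I -> R) : rsummable u -> rsum (fun i => c * u i) = c * rsum u.
Proof.
move=> hu; have [c0|/ltW c0] := leP 0 c; first exact: rsumZ_ge0.
rewrite -[c]opprK mulNr -rsumZ_ge0 ?oppr_ge0// -rsumN.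
by congr rsum; apply/funext => i; rewrite mulNr.
Qed.

Lemma ler_norm_rsum I (u : I -> R) : rsummable u -> `|rsum u| <= fine (psum (fun i => `|u i|)).
Proof.
move=> hu; rewrite /rsum -!/(psum _).
have p0 := fine_psum_ge0 (fun i => max0_ge0 (u i)).
have n0 := fine_psum_ge0 (fun i => max0_ge0 (- u i)).
have -> : psum (fun i => `|u i|) =
    psum (fun i => Num.max (u i) 0 + Num.max (- u i) 0).
  apply: eq_psum => i; have /orP[le|le] := le_total 0 (u i).
    by rewrite max_l// max_r ?oppr_le0// addr0 ger0_norm.
  by rewrite max_r// max_l ?oppr_ge0// add0r ler0_norm.
rewrite psumD; do ?by move=> i; exact: max0_ge0.
rewrite fineD; try by apply: psum_fin_num => // [i|];
  solve [exact: max0_ge0|exact: rsummable_pos|exact: rsummable_neg].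
rewrite ler_norml; move: p0 n0; set x := fine _; set y := fine _ => x0 y0.
by apply/andP; split; lra.
Qed.

Lemma rsum_fiber I K (f : I -> K) (u : I -> R) : rsummable u ->
  rsum (fun k => rsum (fun i => if f i == k then u i else 0)) = rsum u.
Proof.
move=> hu; pose F (a : I -> R) k := fine (psum (fun i => if f i == k then a i else 0)).
pose P (i : I) : R := Num.max (u i) 0; pose N (i : I) : R := Num.max (- u i) 0.
have p0 i : 0 <= P i by exact: max0_ge0.
have n0 i : 0 <= N i by exact: max0_ge0.
have poo := rsummable_pos hu; have noo := rsummable_neg hu.
have fin (a : I -> R) k : (forall i, 0 <= a i) -> psummable a ->
    psummable (fun i => if f i == k then a i else 0).
  by move=> a0; apply: le_lt_trans; apply: le_psum => i; case: ifP.
have foo (a : I -> R) : (forall i, 0 <= a i) -> psummable a -> psummable (F a).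
  by move=> a0 aoo; rewrite /psummable psum_fiber_fine.
have F0 (a : I -> R) k : (forall i, 0 <= a i) -> 0 <= F a k.
  by move=> a0; apply: fine_psum_ge0 => i; case: ifP.
rewrite (@rsum_diff _ u P N)//; last by move=> i; rewrite maxBmaxN.
rewrite (@rsum_diff _ _ (F P) (F N)); first by rewrite !psum_fiber_fine.
- by move=> k; exact: F0.
- by move=> k; exact: F0.
- exact: foo.
- exact: foo.
- move=> k; apply: rsum_diff => [i|i|||i].
  + by case: ifP.
  + by case: ifP.
  + exact: fin.
  + exact: fin.
  + by case: ifP; rewrite ?maxBmaxN ?subrr.
Qed.

End RealSums.

Lemma rsum0 (R : realType) (I : choiceType) : rsum (fun _ : I => 0 : R) = 0.
Proof. by rewrite /rsum oppr0 subrr. Qed.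

Lemma rsum_delta (R : realType) (I : choiceType) (i0 : I) (x : R) :
  rsum (fun i => if i == i0 then x else 0) = x.
Proof.
rewrite (@rsum_diff _ _ _ (fun i => if i == i0 then Num.max x 0 else 0)
    (fun i => if i == i0 then Num.max (- x) 0 else 0)); last first.
- by move=> i; case: ifP; rewrite ?maxBmaxN ?subrr.
- by rewrite /psummable psum_delta ?max0_ge0 ?ltry.
- by rewrite /psummable psum_delta ?max0_ge0 ?ltry.
- by move=> i; case: ifP; rewrite ?max0_ge0.
- by move=> i; case: ifP; rewrite ?max0_ge0.
by rewrite !psum_delta ?max0_ge0 //= maxBmaxN.
Qed.

Section ComplexSums.
Variables (R : realType).
Local Notation normc := (@Normc.normc R).

Lemma abs_summableE (I : choiceType) (u : I -> R[i]) :
  abs_summable u = psummable (fun i => normc (u i)).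
Proof.
rewrite /abs_summable /summable /psummable /psum; congr (is_true (_ < _)%E).
by apply: eq_esum => i _; rewrite gee0_abs// lee_fin normc_ge0.
Qed.

Variables (I K : choiceType).
Implicit Types (u v : I -> R[i]).

Lemma abs_summable_le u (a : I -> R) : (forall i, normc (u i) <= a i) ->
  psummable a -> abs_summable u.
Proof. by move=> h; rewrite abs_summableE; exact: psummable_le. Qed.

Lemma abs_summable_dom u v : (forall i, normc (u i) <= normc (v i)) ->
  abs_summable v -> abs_summable u.
Proof. by move=> h; rewrite [in X in X -> _]abs_summableE; exact: abs_summable_le. Qed.

Lemma abs_summable_Re u : abs_summable u -> rsummable (fun i => complex.Re (u i)).
Proof. by rewrite abs_summableE; apply: psummable_le => i; exact: normc_Re. Qed.

Lemma abs_summable_Im u : abs_summable u -> rsummable (fun i => complex.Im (u i)).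
Proof. by rewrite abs_summableE; apply: psummable_le => i; exact: normc_Im. Qed.

Lemma abs_summableD u v : abs_summable u -> abs_summable v ->
  abs_summable (fun i => u i + v i).
Proof.
rewrite !abs_summableE => hu hv.
apply: psummable_le (psummableD _ _ hu hv) => i; rewrite ?normc_ge0//.
exact: le_normcD.
Qed.

Lemma abs_summableZ (c : R[i]) u : abs_summable u -> abs_summable (fun i => c * u i).
Proof.
rewrite [in X in X -> _]abs_summableE => hu.
apply: (@abs_summable_le _ (fun i => normc c * normc (u i))) => [i|].
  by rewrite Normc.normcM.
by apply: psummableZ => // [|i]; exact: normc_ge0.
Qed.

Lemma abs_summable0 : abs_summable (fun _ : I => 0 : R[i]).
Proof.
by rewrite abs_summableE Normc.normc0 /psummable /psum esum1 ?ltry.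
Qed.

Lemma csumD u v : abs_summable u -> abs_summable v ->
  csum (fun i => u i + v i) = csum u + csum v.
Proof.
move=> hu hv; rewrite /csum; set a := rsum _; set b := rsum _.
have -> : a = rsum (fun i => complex.Re (u i)) + rsum (fun i => complex.Re (v i)).
  rewrite -rsumD; [|exact: abs_summable_Re..].
  by congr rsum; apply/funext => i; case: (u i) (v i) => ? ? [].
have -> : b = rsum (fun i => complex.Im (u i)) + rsum (fun i => complex.Im (v i)).
  rewrite -rsumD; [|exact: abs_summable_Im..].
  by congr rsum; apply/funext => i; case: (u i) (v i) => ? ? [].
by [].
Qed.

Lemma csumZ (c : R[i]) u : abs_summable u -> csum (fun i => c * u i) = c * csum u.
Proof.
move=> hu; have hr := abs_summable_Re hu; have hi := abs_summable_Im hu.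
case: c => x y; rewrite /csum; set a := rsum _; set b := rsum _.
have -> : a = x * rsum (fun i => complex.Re (u i)) + - y * rsum (fun i => complex.Im (u i)).
  rewrite -!rsumZ// -rsumD; [|exact: rsummableZ..].
  by congr rsum; apply/funext => i; case: (u i) => ? ? /=; rewrite mulNr.
have -> : b = x * rsum (fun i => complex.Im (u i)) + y * rsum (fun i => complex.Re (u i)).
  rewrite -!rsumZ// -rsumD; [|exact: rsummableZ..].
  by congr rsum; apply/funext => i; case: (u i).
by rewrite mulNr.
Qed.

Lemma csum0 : csum (fun _ : I => 0 : R[i]) = 0.
Proof. by rewrite /csum /= rsum0. Qed.

Lemma csum_delta (i0 : I) (x : R[i]) : csum (fun i => if i == i0 then x else 0) = x.
Proof.
case: x => x y; rewrite /csum -[in RHS](rsum_delta i0 x) -[in RHS](rsum_delta i0 y).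
by congr Complex; congr rsum; apply/funext => i; case: ifP.
Qed.

Lemma abs_summable_delta (i0 : I) (x : R[i]) :
  abs_summable (fun i => if i == i0 then x else 0).
Proof.
rewrite abs_summableE /psummable.
have -> : (fun i => normc (if i == i0 then x else 0)) =
    (fun i => if i == i0 then normc x else 0).
  by apply/funext => i; case: ifP => // _; exact: Normc.normc0.
by rewrite psum_delta ?normc_ge0// ltry.
Qed.

Lemma csum_seq (s : seq I) u : uniq s -> (forall i, i \notin s -> u i = 0) ->
  abs_summable u /\ csum u = \sum_(i <- s) u i.
Proof.
elim: s u => [|i0 s IH] u /=.
  move=> _ h; have -> : u = fun=> 0 by apply/funext => i; exact: h.
  by rewrite csum0 big_nil; split => //; exact: abs_summable0.
move=> /andP[i0s us] h; pose v i := if i == i0 then 0 else u i.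
have [|hv cv] := IH v us.
  move=> i nis; rewrite /v; case: eqP => // /eqP ne; apply: h.
  by rewrite in_cons negb_or ne.
have E : u = fun i => (if i == i0 then u i0 else 0) + v i.
  by apply/funext => i; rewrite /v; case: eqP => [->|_]; rewrite ?addr0 ?add0r.
split; first by rewrite E; apply: abs_summableD => //; exact: abs_summable_delta.
rewrite [in LHS]E csumD ?csum_delta//; last exact: abs_summable_delta.
rewrite big_cons cv; congr (_ + _).
rewrite big_seq [RHS]big_seq; apply: eq_bigr => i si; rewrite /v.
by case: eqP => // ie; rewrite -ie si in i0s.
Qed.

(** The factor 2 comes from bounding the real and the imaginary part separately; the uses below only
    need some finite bound. *)
Lemma normc_csum u : abs_summable u ->
  normc (csum u) <= 2 * fine (psum (fun i => normc (u i))).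
Proof.
move=> hu; apply: le_trans (normc_leD _) _; rewrite mulr2n mulrDl mul1r.
have hu' : psummable (fun i => normc (u i)) by rewrite -abs_summableE.
apply: lerD.
  apply: le_trans (ler_norm_rsum (abs_summable_Re hu)) _.
  by apply: le_fine_psum => // i; exact: normc_Re.
apply: le_trans (ler_norm_rsum (abs_summable_Im hu)) _.
by apply: le_fine_psum => // i; exact: normc_Im.
Qed.

Lemma abs_summable_fiber (f : I -> K) u : abs_summable u ->
  abs_summable (fun k => csum (fun i => if f i == k then u i else 0)).
Proof.
move=> hu; have hu' : psummable (fun i => normc (u i)) by rewrite -abs_summableE.
pose a k := fine (psum (fun i => if f i == k then normc (u i) else 0)).
have a0 k : 0 <= a k by apply: fine_psum_ge0 => i; case: ifP; rewrite ?normc_ge0.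
rewrite abs_summableE; apply: (@psummable_le _ _ _ (fun k => 2 * a k)).
  move=> k; apply: le_trans (normc_csum _) _.
    by apply: abs_summable_dom hu => i; case: ifP; rewrite ?Normc.normc0 ?normc_ge0.
  rewrite /a; set x := psum _; set y := psum _; suff -> : x = y by [].
  by apply: eq_psum => i; case: ifP; rewrite ?Normc.normc0.
apply: psummableZ => //; rewrite /psummable psum_fiber_fine// => i.
exact: normc_ge0.
Qed.

Lemma csum_fiber (f : I -> K) u : abs_summable u ->
  csum (fun k => csum (fun i => if f i == k then u i else 0)) = csum u.
Proof.
move=> hu; rewrite /csum.
rewrite -[in RHS](rsum_fiber f (abs_summable_Re hu)).
rewrite -[in RHS](rsum_fiber f (abs_summable_Im hu)).
by congr Complex; congr rsum; apply/funext => k /=; congr rsum;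
  apply/funext => i; case: ifP.
Qed.

End ComplexSums.

(** * Change of index and products of unordered sums *)

Section SumsOverProducts.
Variable R : realType.
Implicit Types (I J K : choiceType).

Lemma csum_single I (u : I -> R[i]) i0 : (forall i, i != i0 -> u i = 0) ->
  csum u = u i0.
Proof.
move=> h; rewrite -[RHS](csum_delta i0); congr csum; apply/funext => i.
by case: eqP => [->//|/eqP]; exact: h.
Qed.

(** [v] is [u] transported along [f] and extended by zero: its value at [k] is the sum of [u] over
    the fibre of [k], which is a singleton or empty. *)
Lemma csum_inj I K (f : I -> K) (u : I -> R[i]) (v : K -> R[i]) :
  injective f -> (forall i, v (f i) = u i) ->
  (forall k, (forall i, f i != k) -> v k = 0) -> abs_summable u ->
  abs_summable v /\ csum v = csum u.
Proof.
move=> fi vf v0 hu.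
suff -> : v = fun k => csum (fun i => if f i == k then u i else 0).
  by split; [exact: abs_summable_fiber|exact: csum_fiber].
apply/funext => k; have [[i <-]|nk] := pselect (exists i, f i = k).
  rewrite vf (@csum_single _ _ i) ?eqxx// => j ji.
  by rewrite (inj_eq fi) (negbTE ji).
have nk' i : f i != k by apply/eqP => e; apply: nk; exists i.
rewrite v0//; rewrite -[LHS](csum0 R I); congr csum; apply/funext => i.
by rewrite (negbTE (nk' i)).
Qed.

Lemma csum_bij I K (f : I -> K) (v : K -> R[i]) : bijective f ->
  abs_summable (v \o f) -> abs_summable v /\ csum v = csum (v \o f).
Proof.
move=> [g fK gK] h; apply: (csum_inj (can_inj fK)) => // k nk.
by have := nk (g k); rewrite gK eqxx.
Qed.

(** Tonelli: fibring along [fst] and then along [snd], the moduli in the row of [i] add up to |u_i|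
    times the total [V] of |v|. *)
Lemma abs_summable_pair I J (u : I -> R[i]) (v : J -> R[i]) :
  abs_summable u -> abs_summable v -> abs_summable (fun p : I * J => u p.1 * v p.2).
Proof.
rewrite !abs_summableE => hu hv; rewrite /psummable (psum_fiber fst); last first.
  by move=> p; exact: normc_ge0.
set V := fine (psum (fun j => Normc.normc (v j))).
have V0 : 0 <= V by apply: fine_psum_ge0 => j; exact: normc_ge0.
have nu i : 0 <= Normc.normc (u i) by exact: normc_ge0.
have nv i : 0 <= Normc.normc (v i) by exact: normc_ge0.
suff E i : psum (fun p : I * J => if p.1 == i then Normc.normc (u p.1 * v p.2) else 0)
    = (V * Normc.normc (u i))%:E.
  by under eq_esum do rewrite E; rewrite -/(psum _) psum_scale// lte_mul_pinfty ?lee_fin.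
rewrite mulrC EFinM psum_fine// -psum_scale// (psum_fiber snd); last first.
  by move=> p; case: ifP; rewrite ?normc_ge0.
apply: eq_esum => j _; rewrite -[RHS](psum_delta (i, j)) ?mulr_ge0//.
apply: eq_psum => -[i' j'] /=; rewrite xpair_eqE Normc.normcM.
by case: (i' =P i) => [->|_]; case: (j' =P j) => //= ->.
Qed.

Lemma csum_pair I J (u : I -> R[i]) (v : J -> R[i]) :
  abs_summable u -> abs_summable v ->
  csum (fun p : I * J => u p.1 * v p.2) = csum u * csum v.
Proof.
move=> hu hv; have huv := abs_summable_pair hu hv.
rewrite -(csum_fiber fst huv) mulrC -csumZ//; congr csum; apply/funext => i.
rewrite mulrC -csumZ// -(csum_fiber snd); last first.
  by apply: abs_summable_dom huv => p; case: ifP; rewrite ?Normc.normc0 ?normc_ge0.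
congr csum; apply/funext => j; rewrite (@csum_single _ _ (i, j)) /= ?eqxx// => -[i' j'].
rewrite xpair_eqE /=; case: (i' =P i) => [->|_]; case: (j' =P j) => //= ->.
Qed.

(** Splitting off coordinate [ord0] turns K^{n+1} into K * K^n, where [csum_pair] applies. With
    [K = nat] this factors multi-index power series, with [K = int * bool] sums over Jackson
    lattices. *)
Lemma csum_ffun K (n : nat) (u : 'I_n -> K -> R[i]) :
  (forall j, abs_summable (u j)) ->
  abs_summable (fun e : {ffun 'I_n -> K} => \prod_j u j (e j)) /\
  csum (fun e : {ffun 'I_n -> K} => \prod_j u j (e j)) = \prod_j csum (u j).
Proof.
elim: n u => [|n IH] u hu.
  have [x0 hx0] : exists x : {ffun 'I_0 -> K}, forall y, y = x.
    (* [K] may be empty, so the empty function is defined by eliminating the impossible index. *)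
    exists [ffun i : 'I_0 => match notF (ltn_ord i) with end] => y.
    by apply/ffunP => -[].
  have -> : (fun e : {ffun 'I_0 -> K} => \prod_j u j (e j)) =
      (fun e => if e == x0 then 1 else 0).
    by apply/funext => e; rewrite big_ord0 (hx0 e) eqxx.
  by rewrite csum_delta big_ord0; split => //; exact: abs_summable_delta.
have [hS cS] := IH (fun j => u (lift ord0 j)) (fun j => hu (lift ord0 j)).
pose f (p : K * {ffun 'I_n -> K}) : {ffun 'I_n.+1 -> K} :=
  [ffun i => if unlift ord0 i is Some j then p.2 j else p.1].
pose g (e : {ffun 'I_n.+1 -> K}) := (e ord0, [ffun j => e (lift ord0 j)]).
have bf : bijective f.
  exists g => [[k e]|e].
    rewrite /g ffunE unlift_none; congr (_, _); apply/ffunP => j.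
    by rewrite !ffunE liftK.
  apply/ffunP => i; rewrite ffunE; case: unliftP => [j ->|->]//=.
  by rewrite ffunE.
have E : (fun e : {ffun 'I_n.+1 -> K} => \prod_j u j (e j)) \o f = fun p => u ord0 p.1 *
    (\prod_j u (lift ord0 j) (p.2 j)).
  apply/funext => p /=; rewrite big_ord_recl ffunE unlift_none; congr (_ * _).
  by apply: eq_bigr => j _; rewrite ffunE liftK.
have [|h1 h2] := csum_bij bf (v := fun e : {ffun 'I_n.+1 -> K} => \prod_j u j (e j)).
  by rewrite E; exact: (abs_summable_pair (hu ord0) hS).
by split => //; rewrite h2 E (csum_pair (hu ord0) hS) cS big_ord_recl.
Qed.

End SumsOverProducts.

(** * Power series in one complex variable *)

Section SequenceSums.
Variable R : realType.
Local Notation normc := (@Normc.normc R).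

Lemma normc_nat k : normc k%:R = k%:R.
Proof. by rewrite -(rmorph_nat (real_complex R)) normc_real ger0_norm ?ler0n. Qed.

Lemma psum_seq (I : choiceType) (s : seq I) (a : I -> R) : uniq s ->
  (forall i, 0 <= a i) -> (forall i, i \notin s -> a i = 0) ->
  psum a = (\sum_(i <- s) a i)%:E.
Proof.
elim: s a => [|i0 s IH] a /=.
  move=> _ _ h; have -> : a = fun=> 0 by apply/funext => i; exact: h.
  by rewrite big_nil /psum esum1.
move=> /andP[i0s us] a0 h; pose v i := if i == i0 then 0 else a i.
have v0 i : 0 <= v i by rewrite /v; case: ifP.
have E : a = fun i => (if i == i0 then a i0 else 0) + v i.
  by apply/funext => i; rewrite /v; case: eqP => [->|_]; rewrite ?addr0 ?add0r.
rewrite [in LHS]E psumD//; last by move=> i; case: ifP.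
rewrite psum_delta// big_cons EFinD; congr (_ + _)%E; rewrite IH//; last first.
  move=> i nis; rewrite /v; case: eqP => // /eqP ne; apply: h.
  by rewrite in_cons negb_or ne.
congr EFin; rewrite big_seq [RHS]big_seq; apply: eq_bigr => i si; rewrite /v.
by case: eqP => // ie; rewrite -ie si in i0s.
Qed.

Lemma psummable_inj (I K : choiceType) (f : I -> K) (a : K -> R) :
  injective f -> (forall k, 0 <= a k) -> psummable a -> psummable (a \o f).
Proof.
move=> fi a0; apply: le_lt_trans; rewrite /psum.
rewrite -(esum_image [set: I] f (fun k => (a k)%:E)); last by move=> i j _ _ /fi.
by rewrite esum_mkcond; apply: le_esum => k _; case: ifP; rewrite ?lee_fin.
Qed.

Lemma abs_summable_inj (I K : choiceType) (f : I -> K) (u : K -> R[i]) :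
  injective f -> abs_summable u -> abs_summable (u \o f).
Proof.
move=> fi; rewrite !abs_summableE; apply: (psummable_inj fi) => k.
exact: normc_ge0.
Qed.

Lemma csum_recl (u : nat -> R[i]) : abs_summable u ->
  csum u = u 0%N + csum (u \o S).
Proof.
move=> hu; pose v k := if k is k'.+1 then u k'.+1 else 0.
have huS : abs_summable (u \o S) by apply: abs_summable_inj hu; exact: succn_inj.
have [||hv cv] := @csum_inj _ _ _ S (u \o S) v succn_inj _ _ huS => //.
  by case=> // k /(_ k); rewrite eqxx.
have E : u = fun k => (if k == 0%N then u 0%N else 0) + v k.
  by apply/funext => -[|k]; rewrite ?addr0 ?add0r.
by rewrite [in LHS]E csumD ?csum_delta ?cv//; exact: abs_summable_delta.
Qed.

Lemma psummable_bounded (a : nat -> R) (M : R) : (forall k, 0 <= a k) ->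
  (forall k, \sum_(i < k) a i <= M) -> psummable a.
Proof.
move=> a0 h; apply: (@le_lt_trans _ _ M%:E); last exact: ltry.
rewrite /psum -nneseries_esumT; last by move=> k; rewrite lee_fin.
apply: lime_le; first by apply: is_cvg_nneseries => k _ _; rewrite lee_fin.
by apply: nearW => k; rewrite sumEFin big_mkord lee_fin.
Qed.

Lemma psummable_geometric (x : R) : 0 <= x < 1 -> psummable (fun k => x ^+ k).
Proof.
move=> /andP[x0 x1]; apply: (@psummable_bounded _ (1 - x)^-1) => [k|k].
  exact: exprn_ge0.
rewrite -[leRHS]mul1r ler_pdivlMr ?subr_gt0// mulrC.
have := subrX1 x k; have : 0 <= x ^+ k by exact: exprn_ge0.
by move: (\sum_(i < k) _) (x ^+ k) => y w; lra.
Qed.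

(** Ratio test by comparison with the geometric series M x^k. *)
Lemma psummable_ratio (a : nat -> R) (N : nat) (x : R) : 0 < x < 1 ->
  (forall k, 0 <= a k) -> (forall k, (N <= k)%N -> a k.+1 <= x * a k) ->
  psummable a.
Proof.
(* [M] is at least a_i / x^i for every i <= N, which settles the initial terms; the ratio bound
   propagates the estimate from there. *)
move=> /andP[x0 x1] a0 h; pose M := \sum_(i < N.+1) a i / x ^+ i.
have t0 i : 0 <= a i / x ^+ i by rewrite divr_ge0// exprn_ge0// ltW.
have M0 : 0 <= M by apply: sumr_ge0 => i _.
apply: (@psummable_le _ _ _ (fun k => M * x ^+ k)); last first.
  apply: psummableZ => // [k|]; first by rewrite exprn_ge0// ltW.
  by apply: psummable_geometric; rewrite ltW.
have small k : (k <= N)%N -> a k <= M * x ^+ k.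
  move=> kN; rewrite -ler_pdivrMr ?exprn_gt0//.
  rewrite /M (bigD1 (Ordinal (kN : k < N.+1)%N))//= lerDl.
  by apply: sumr_ge0 => i _.
elim=> [|k IH]; first exact: small.
have [/small//|Nk] := leqP k.+1 N.
by apply: le_trans (h _ Nk) _; rewrite exprS mulrCA ler_pM2l.
Qed.

Lemma csum_geometric (z : R[i]) : normc z < 1 ->
  abs_summable (fun k => z ^+ k) /\ csum (fun k => z ^+ k) = (1 - z)^-1.
Proof.
move=> z1; have hz : abs_summable (fun k => z ^+ k).
  rewrite abs_summableE; have -> : (fun k => normc (z ^+ k)) = (fun k => normc z ^+ k).
    by apply/funext => k; rewrite normcX.
  by apply: psummable_geometric; rewrite normc_ge0.
split=> //; have nz : 1 - z != 0.
  rewrite subr_eq0; apply: contraTneq z1 => <-.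
  by rewrite -[X in normc X]/(1%:C) normc_real normr1 ltxx.
(* Dropping the term of index 0 leaves z times the same sum S, so (1 - z) S = 1. *)
apply: (mulfI nz); rewrite divff// mulrBl mul1r {1}csum_recl// expr0.
have -> : (fun k => z ^+ k) \o S = fun k => z * z ^+ k.
  by apply/funext => k /=; rewrite exprS.
by rewrite csumZ// addrK.
Qed.

End SequenceSums.

Section PowerSeries.
Variable R : realType.
Local Notation normc := (@Normc.normc R).
Implicit Types (b c : nat -> R[i]) (p z h : R[i]) (r : R) (f g : R[i] -> R[i]).

Definition pseries_at b p r f := forall z, normc (z - p) < r ->
  abs_summable (fun k => b k * (z - p) ^+ k) /\
  f z = csum (fun k => b k * (z - p) ^+ k).

Definition analytic_at f p := exists b r, 0 < r /\ pseries_at b p r f.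

Lemma abs_summable_pseries b z h : normc h <= normc z ->
  abs_summable (fun k => b k * z ^+ k) -> abs_summable (fun k => b k * h ^+ k).
Proof.
move=> hz; apply: abs_summable_dom => k; rewrite !Normc.normcM !normcX.
by rewrite ler_wpM2l ?normc_ge0// lerXn2r// nnegrE normc_ge0.
Qed.

(** The terms of positive degree share a factor h, and the cofactor is bounded on the disc by its
    absolute sum at [x]. This estimate serves as continuity at 0, both for the identity theorem and
    for the q-exponential. *)
Lemma csum_pseries_lip b (x : R) : 0 < x ->
  abs_summable (fun k => b k * x%:C ^+ k) ->
  exists2 M, 0 <= M & forall h, normc h <= x ->
    normc (csum (fun k => b k * h ^+ k) - b 0%N) <= M * normc h.
Proof.
move=> x0 hb; have nx : normc x%:C = x by rewrite normc_real gtr0_norm.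
have hS : abs_summable (fun k => b k.+1 * x%:C ^+ k).
  have xn0 : x%:C != 0 :> R[i] by rewrite -(rmorph0 (real_complex R)) (inj_eq (@complexI R)) gt_eqF.
  have := abs_summableZ x%:C^-1 (abs_summable_inj succn_inj hb).
  congr abs_summable; apply/funext => k /=.
  by rewrite exprS [b _ * _]mulrCA mulKf.
exists (2 * fine (psum (fun k => normc (b k.+1 * x%:C ^+ k)))).
  by rewrite mulr_ge0// fine_psum_ge0// => k; exact: normc_ge0.
move=> h hx; have hh := abs_summable_pseries (z := x%:C) (h := h) _ hb.
have hhS : abs_summable (fun k => b k.+1 * h ^+ k).
  by apply: (abs_summable_pseries (b := b \o S) _ hS); rewrite nx.
rewrite csum_recl; last by apply: hh; rewrite nx.
rewrite expr0 mulr1 addrC addKr.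
have -> : (fun k => b k * h ^+ k) \o S = fun k => h * (b k.+1 * h ^+ k).
  by apply/funext => k /=; rewrite exprS mulrCA.
rewrite csumZ// Normc.normcM mulrC ler_wpM2r ?normc_ge0//.
apply: le_trans (normc_csum hhS) _; rewrite ler_wpM2l//.
apply: le_fine_psum => [k|k|]; first exact: normc_ge0.
  rewrite !Normc.normcM !normcX nx ler_wpM2l ?normc_ge0//.
  by rewrite lerXn2r// nnegrE ?normc_ge0// ltW.
by rewrite -abs_summableE.
Qed.

(** Cauchy product: the double family is summed along antidiagonals, the fibres of [x.1 + x.2]. *)
Lemma pseries_mul b c p r f g : pseries_at b p r f -> pseries_at c p r g ->
  pseries_at (fun k => \sum_(i < k.+1) b i * c (k - i)%N) p r (fun z => f z * g z).
Proof.
move=> hf hg z zr; have [sf ef] := hf z zr; have [sg eg] := hg z zr.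
set h := z - p in sf ef sg eg *.
have sfg := abs_summable_pair sf sg.
have E : (fun k => csum (fun x : nat * nat => if (x.1 + x.2)%N == k
      then b x.1 * h ^+ x.1 * (c x.2 * h ^+ x.2) else 0)) =
    (fun k => (\sum_(i < k.+1) b i * c (k - i)%N) * h ^+ k).
  apply/funext => k.
  have [||_ ->] := @csum_seq _ _ [seq (i, k - i)%N | i <- iota 0 k.+1]
     (fun x : nat * nat => if (x.1 + x.2)%N == k
      then b x.1 * h ^+ x.1 * (c x.2 * h ^+ x.2) else 0).
  - by rewrite map_inj_uniq ?iota_uniq// => i j [].
  - move=> [i j] nin; case: eqP => // e; case/negP: nin; apply/mapP; exists i.
      by rewrite mem_iota /= add0n ltnS -e leq_addr.
    by rewrite -e addKn.
  rewrite big_map -[iota _ _]/(index_iota 0 k.+1) big_mkord big_distrl /=.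
  apply: eq_bigr => i _; have ik : (i <= k)%N by rewrite -ltnS.
  have -> : h ^+ k = h ^+ i * h ^+ (k - i) by rewrite -exprD subnKC.
  by rewrite subnKC// eqxx; ring.
split; first by rewrite -E; apply: (abs_summable_fiber (fun x : nat * nat => (x.1 + x.2)%N)).
by rewrite -E (csum_fiber (fun x : nat * nat => (x.1 + x.2)%N) sfg) ef eg (csum_pair sf sg).
Qed.

Lemma pseries_sub b p r r' f : r' <= r -> pseries_at b p r f -> pseries_at b p r' f.
Proof. by move=> h hf z zr; apply: hf; exact: lt_le_trans h. Qed.

Lemma pseries_poly (P : {poly R[i]}) r : pseries_at (fun k => P`_k) 0 r (fun z => P.[z]).
Proof.
move=> z _; rewrite subr0.
have [|h ->] := @csum_seq _ _ (iota 0 (size P)) (fun k => P`_k * z ^+ k) (iota_uniq _ _).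
  by move=> k; rewrite mem_iota add0n -leqNgt => h; rewrite nth_default// mul0r.
by split => //; rewrite horner_coef -[X in iota _ X]subn0 big_mkord.
Qed.

Lemma analytic_ext f g p r : 0 < r -> (forall z, normc (z - p) < r -> f z = g z) ->
  analytic_at f p -> analytic_at g p.
Proof.
move=> r0 fg [b [r' [r'0 hf]]]; exists b, (Num.min r r').
split; first by rewrite lt_min r0.
by move=> z; rewrite lt_min => /andP[zr zr']; rewrite -fg//; exact: hf.
Qed.

Lemma analytic_mul f g p : analytic_at f p -> analytic_at g p ->
  analytic_at (fun z => f z * g z) p.
Proof.
move=> [b [r [r0 hf]]] [c [r' [r'0 hg]]].
exists (fun k => \sum_(i < k.+1) b i * c (k - i)%N), (Num.min r r').
split; first by rewrite lt_min r0.
by apply: pseries_mul; [apply: pseries_sub hf|apply: pseries_sub hg];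
  rewrite ge_min lexx ?orbT.
Qed.

Lemma analytic_prod (I : Type) (s : seq I) (F : I -> R[i] -> R[i]) p :
  (forall i, analytic_at (F i) p) -> analytic_at (fun z => 1) p ->
  analytic_at (fun z => \prod_(i <- s) F i z) p.
Proof.
move=> hF h1; elim: s => [|i s IH].
  by apply: (analytic_ext ltr01 _ h1) => z _; rewrite big_nil.
apply: (analytic_ext ltr01 _ (analytic_mul (hF i) IH)) => z _.
by rewrite big_cons.
Qed.

Lemma analytic_inv_linear (c : R[i]) p : 1 - c * p != 0 ->
  analytic_at (fun z => (1 - c * z)^-1) p.
Proof.
move=> nz; pose d := c / (1 - c * p).
have d0 : 0 < normc d + 1 by rewrite ltr_wpDl ?normc_ge0.
exists (fun k => (1 - c * p)^-1 * d ^+ k), (normc d + 1)^-1.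
split; first by rewrite invr_gt0.
move=> z zr; have dz : normc (d * (z - p)) < 1.
  rewrite Normc.normcM; move: zr; rewrite -[X in _ < X -> _]mul1r ltr_pdivlMr// mulrC.
  by apply: le_lt_trans; rewrite ler_wpM2r ?normc_ge0// lerDl.
have [s e] := csum_geometric dz.
have -> : (fun k => (1 - c * p)^-1 * d ^+ k * (z - p) ^+ k) =
    (fun k => (1 - c * p)^-1 * (d * (z - p)) ^+ k).
  by apply/funext => k; rewrite -mulrA -exprMn.
split; first exact: abs_summableZ.
rewrite csumZ// e -invfM; congr (_^-1); rewrite mulrBr mulr1 /d.
by field.
Qed.

(** Expand (p + h)^k by the binomial formula into the double family [U h]. Its k-th row has moduli
    summing to |b_k| (|p| + |h|)^k, so it is absolutely summable inside the disc; summing rows gives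
    f(p + h), summing columns gives the expansion at [p]. *)
Lemma analytic_interior b r f p : pseries_at b 0 r f -> normc p < r -> analytic_at f p.
Proof.
move=> hf pr; pose U h (x : nat * nat) := b x.1 * ('C(x.1, x.2)%:R * p ^+ (x.1 - x.2)) * h ^+ x.2.
have key h : normc p + normc h < r -> abs_summable (U h) /\ csum (U h) = f (p + h).
  move=> hr; pose x := normc p + normc h.
  have x0 : 0 <= x by rewrite addr_ge0 ?normc_ge0.
  have [|sx _] := hf x%:C.
    by rewrite subr0 normc_real ger0_norm.
  pose s k := [seq (k, j) | j <- iota 0 k.+1].
  have us k : uniq (s k) by rewrite map_inj_uniq ?iota_uniq// => i j [].
  have off k : forall y : nat * nat, y \notin s k -> (y.1 == k) = true -> U h y = 0.
    move=> [i j] /= nin /eqP e; rewrite /U /= bin_small ?mul0r ?mulr0 ?mul0r//.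
    rewrite ltnNge; apply: contra nin => ji; apply/mapP; exists j; last by rewrite e.
    by rewrite mem_iota add0n ltnS -e.
  have bino (S : comNzRingType) (a c : S) k :
      \sum_(y <- s k) 'C(y.1, y.2)%:R * a ^+ (y.1 - y.2) * c ^+ y.2 = (a + c) ^+ k.
    rewrite big_map -[iota _ _]/(index_iota 0 k.+1) big_mkord exprDn.
    by apply: eq_bigr => i _ /=; rewrite mulr_natl mulrnAl.
  have sU : abs_summable (U h).
    rewrite abs_summableE /psummable (psum_fiber fst); last by move=> y; exact: normc_ge0.
    move: sx; rewrite abs_summableE subr0; congr (_ < _)%E; apply: eq_esum => k _.
    rewrite (@psum_seq _ _ (s k))//; last first.
    + by move=> y /off; case: ifP => // _ /(_ erefl) ->; rewrite Normc.normc0.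
    + by move=> y; case: ifP; rewrite ?normc_ge0.
    rewrite Normc.normcM normcX normc_real ger0_norm// /x -bino mulr_sumr.
    congr EFin; rewrite big_seq [RHS]big_seq; apply: eq_bigr => y /mapP[j _ ->] /=.
    rewrite eqxx /U /= !Normc.normcM !normcX -!mulrA; congr (_ * (_ * _)).
    by rewrite normc_nat.
  split=> //; rewrite -(csum_fiber fst sU).
  have [|_ ->] := hf (p + h).
    by rewrite subr0; apply: le_lt_trans hr; exact: le_normcD.
  congr csum; apply/funext => k; rewrite subr0.
  have [|_ ->] := @csum_seq _ _ (s k) (fun y : nat * nat => if y.1 == k then U h y else 0) (us k).
    by move=> y /off; case: ifP => // _ /(_ erefl) ->.
  rewrite -bino mulr_sumr big_seq [RHS]big_seq; apply: eq_bigr => y /mapP[j _ ->] /=.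
  by rewrite eqxx /U /=; ring.
pose r' := r - normc p; have r'0 : 0 < r' by rewrite subr_gt0.
pose B j := csum (fun x : nat * nat => if x.2 == j then U 1 x else 0).
exists B, r'; split=> // z zr; set h := z - p.
have [|sU eU] := key h; first by rewrite -ltrBrDl.
have E : (fun j => csum (fun x : nat * nat => if x.2 == j then U h x else 0)) = (fun j => B j * h ^+ j).
  (* The column defining [B j] must converge by itself; this follows from summability at one
     non-zero [y] in the disc, divided by [y ^+ j]. *)
  apply/funext => j; pose y := (r' / 2)%:C.
  have yn0 : y != 0 by rewrite -(rmorph0 (real_complex R)) (inj_eq (@complexI R)) gt_eqF// divr_gt0.
  have [|sy _] := key y.
    rewrite normc_real ger0_norm; last by rewrite divr_ge0// ltW.
    by rewrite /r' in r'0 *; lra.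
  have s1 : abs_summable (fun x : nat * nat => if x.2 == j then U 1 x else 0).
    have := abs_summableZ (y ^- j) sy.
    apply: abs_summable_dom => x; case: ifP => [/eqP <-|_]; last first.
      by rewrite Normc.normc0 normc_ge0.
    by rewrite /U expr1n mulr1 [X in _ <= Normc.normc X]mulrC mulfK// expf_neq0.
  rewrite /B mulrC -csumZ//; congr csum; apply/funext => x; case: ifP => [/eqP <-|_].
    by rewrite /U expr1n mulr1 mulrC.
  by rewrite mulr0.
rewrite -E; split; first exact: abs_summable_fiber.
by rewrite (csum_fiber snd sU) eU /h addrC subrK.
Qed.

Lemma analytic_poly (P : {poly R[i]}) p : analytic_at (fun z => P.[z]) p.
Proof.
apply: (analytic_interior (b := fun k => P`_k) (r := normc p + 1)).
  exact: pseries_poly.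
by rewrite ltrDl.
Qed.

Lemma analytic_scale (c : R[i]) f p : analytic_at f (c * p) ->
  analytic_at (fun z => f (c * z)) p.
Proof.
move=> [b [r [r0 hf]]]; have c0 : 0 < normc c + 1 by rewrite ltr_wpDl ?normc_ge0.
exists (fun k => b k * c ^+ k), (r / (normc c + 1)); split; first exact: divr_gt0.
move=> z zr; have [] := hf (c * z).
  rewrite -mulrBr Normc.normcM; move: zr; rewrite ltr_pdivlMr// mulrC.
  by apply: le_lt_trans; rewrite ler_wpM2r ?normc_ge0// lerDl.
by rewrite -mulrBr; under eq_fun do rewrite exprMn mulrA.
Qed.

End PowerSeries.

(** * Uniqueness of the continuation on real points *)

Section IdentityTheorem.
Variable R : realType.
Local Notation normc := (@Normc.normc R).

Lemma realC_neq0 (x : R) : (x%:C != 0 :> R[i]) = (x != 0).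
Proof. by rewrite -(rmorph0 (real_complex R)) (inj_eq (@complexI R)). Qed.

(** By strong induction the lower coefficients vanish; dividing by x^k leaves a series that is zero
    for small x < 0 and differs from b_k by O(|x|). Zeros are assumed on the left only, which is all
    that is known at the supremum of an interval of zeros. *)
Lemma pseries_coef_eq0 (b : nat -> R[i]) (r d : R) : 0 < r -> 0 < d ->
  (forall x : R, `|x| < r -> abs_summable (fun k => b k * x%:C ^+ k)) ->
  (forall x : R, - d < x < 0 -> csum (fun k => b k * x%:C ^+ k) = 0) ->
  forall k, b k = 0.
Proof.
move=> r0 d0 hs hz k; elim/ltn_ind: k => k IH.
pose c m := b (k + m)%N.
have hc (x : R) : `|x| < r -> x != 0 -> abs_summable (fun m => c m * x%:C ^+ m) /\
    csum (fun m => b m * x%:C ^+ m) = x%:C ^+ k * csum (fun m => c m * x%:C ^+ m).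
  move=> xr xn0; have xC0 : x%:C ^+ k != 0 :> R[i] by rewrite expf_neq0// realC_neq0.
  have sc : abs_summable (fun m => c m * x%:C ^+ m).
    have := abs_summableZ (x%:C ^- k) (abs_summable_inj (@addnI k) (hs x xr)).
    congr abs_summable; apply/funext => m /=.
    by rewrite exprD mulrCA mulKf.
  split => //; rewrite -csumZ//; have sc' := abs_summableZ (x%:C ^+ k) sc.
  have [||_ ->//] := csum_inj (@addnI k) (v := fun m => b m * x%:C ^+ m) _ _ sc'.
    by move=> m; rewrite exprD mulrCA.
  move=> m hm; rewrite IH ?mul0r// ltnNge; apply/negP => km.
  by have := hm (m - k)%N; rewrite subnKC// eqxx.
pose x0 := r / 2; have x00 : 0 < x0 by rewrite divr_gt0.
have x0r : `|x0| < r by rewrite gtr0_norm// /x0; lra.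
have [sx0 _] := hc x0 x0r (lt0r_neq0 x00).
have [M M0 hM] := csum_pseries_lip x00 sx0.
have bound (e : R) : 0 < e -> e < d -> e <= x0 -> normc (b k) <= M * e.
  move=> e0 ed ex; have er : `|- e| < r.
    by rewrite normrN; apply: le_lt_trans x0r; rewrite !gtr0_norm.
  have en0 : - e != 0 by rewrite oppr_eq0 gt_eqF.
  have [_ ec] := hc (- e) er en0.
  have := hM (- e)%:C; rewrite normc_real normrN gtr0_norm// => /(_ ex).
  suff -> : csum (fun m => c m * (- e)%:C ^+ m) = 0 by rewrite sub0r normcN /c addn0.
  apply: (@mulfI _ ((- e)%:C ^+ k)); first by rewrite expf_neq0// realC_neq0.
  by rewrite -ec mulr0 hz// oppr_lt0 e0 andbT ltrN2.
apply: Normc.eq0_normc; apply/eqP; rewrite eq_le normc_ge0 andbT.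
apply/ler_addgt0Pr => e e0; rewrite add0r.
(* The three bounds keep -t in the interval of zeros, inside the radius of the Lipschitz estimate,
   and make M t at most e. *)
pose t := Num.min (Num.min (d / 2) x0) (e / (M + 1)).
have M1 : 0 < M + 1 by rewrite ltr_wpDl.
have t0 : 0 < t by rewrite !lt_min !divr_gt0.
apply: le_trans (bound t t0 _ _) _.
- by apply: (@le_lt_trans _ _ (d / 2)); [rewrite !ge_min lexx|lra].
- by rewrite !ge_min lexx orbT.
apply: (@le_trans _ _ ((M + 1) * t)); first by rewrite ler_wpM2r ?(ltW t0)// lerDl.
by rewrite mulrC -ler_pdivlMr// ge_min lexx orbT.
Qed.

Definition real_analytic (f : R -> R[i]) := forall t, exists b r, 0 < r /\
  forall s, `|s - t| < r -> abs_summable (fun k => b k * (s - t)%:C ^+ k) /\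
    f s = csum (fun k => b k * (s - t)%:C ^+ k).

(** Connectedness argument: let t be the supremum of the x such that [f] vanishes on [0, x]. The
    expansion at t has zeros on its left, hence vanishes identically, and the interval of zeros
    extends beyond t. *)
Lemma real_analytic_eq0 (f : R -> R[i]) (d : R) : real_analytic f -> 0 < d ->
  (forall s, `|s| < d -> f s = 0) -> forall s, 0 <= s -> f s = 0.
Proof.
move=> hf d0 h0 s s0; apply: contrapT => fs.
pose S := [set x : R | 0 <= x /\ forall y, 0 <= y <= x -> f y = 0].
have ubS : ubound S s.
  by move=> x [x0 hx]; rewrite leNgt; apply/negP => sx; apply: fs; apply: hx; rewrite s0 ltW.
have S0 : S (d / 2).
  split=> [|y /andP[y0 yd]]; first by rewrite divr_ge0// ltW.
  by apply: h0; rewrite ger0_norm//; apply: le_lt_trans yd _; lra.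
have supS : has_sup S by split; [exists (d / 2)|exists s].
pose t := sup S.
have td : d / 2 <= t by apply: ub_le_sup => //; exists s.
have below y : 0 <= y < t -> f y = 0.
  move=> /andP[y0 yt]; have ty : 0 < t - y by rewrite subr_gt0.
  have [x [x0 hx] xy] := sup_adherent ty supS.
  by apply: hx; rewrite y0; move: xy; rewrite -/t; lra.
have [b [r [r0 hb]]] := hf t.
have b0 : forall k, b k = 0.
  apply: (@pseries_coef_eq0 b r (Num.min r t)) => //.
  - by rewrite lt_min r0; lra.
  - by move=> x xr; have := hb (t + x); rewrite addrAC subrr add0r => /(_ xr)[].
  - move=> x /andP[]; rewrite ltrNl lt_min => /andP[xr xt] x0.
    have := hb (t + x); rewrite addrAC subrr add0r ltr0_norm// => /(_ xr)[_ <-].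
    by apply: below; apply/andP; split; lra.
suff : S (t + r / 2) by move=> /(ub_le_sup (ex_intro _ s ubS)); rewrite -/t; lra.
split=> [|y /andP[y0 ytr]]; first lra.
have [yt|ty] := ltP y t; first by apply: below; rewrite y0.
have [|_ ->] := hb y; first by rewrite ger0_norm ?subr_ge0//; lra.
by rewrite -[RHS](csum0 R nat); congr csum; apply/funext => k; rewrite b0 mul0r.
Qed.

Lemma real_analyticB f g : real_analytic f -> real_analytic g ->
  real_analytic (fun t => f t - g t).
Proof.
move=> hf hg t; have [b [r [r0 hb]]] := hf t; have [c [r' [r'0 hc]]] := hg t.
exists (fun k => b k + -1 * c k), (Num.min r r'); split; first by rewrite lt_min r0.
move=> s; rewrite lt_min => /andP[/hb[sb ->] /hc[sc ->]].
have sc' := abs_summableZ (-1) sc.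
have -> : (fun k => (b k + -1 * c k) * (s - t)%:C ^+ k) =
    fun k => b k * (s - t)%:C ^+ k + -1 * (c k * (s - t)%:C ^+ k).
  by apply/funext => k; rewrite mulrDl mulrA.
by split; [exact: abs_summableD|rewrite csumD// csumZ// mulN1r].
Qed.

Variable n : nat.

Lemma monomial_scale (e : mindex n) (c : R[i]) (v : 'rV[R[i]]_n) :
  monomial e (c *: v) = c ^+ mdeg e * monomial e v.
Proof.
rewrite /monomial /mdeg -prodrXr -big_split /=; apply: eq_bigr => j _.
by rewrite mxE exprMn.
Qed.

(** On the line p + x v the monomial of multi-index e contributes x^{|e|}, so grouping by total
    degree gives a series in one variable. *)
Lemma power_series_line (c : mindex n -> R[i]) (p v : 'rV[R[i]]_n) (r : R)
    (F : 'rV[R[i]]_n -> R[i]) : 0 < r -> power_series_at c p r F ->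
  exists b r', 0 < r' /\ forall x : R, `|x| < r' ->
    abs_summable (fun k => b k * x%:C ^+ k) /\
    F (p + x%:C *: v) = csum (fun k => b k * x%:C ^+ k).
Proof.
move=> r0 hF; pose m := \sum_j normc (v 0 j) + 1.
have m0 : 0 < m by rewrite ltr_wpDl// sumr_ge0// => j _; exact: normc_ge0.
have vm j : normc (v 0 j) <= m.
  rewrite /m (bigD1 j)//= -addrA lerDl addr_ge0// sumr_ge0// => i _; exact: normc_ge0.
pose r' := r / m; have r'0 : 0 < r' by exact: divr_gt0.
have key (x : R) : `|x| < r' -> abs_summable (fun e => c e * monomial e v * x%:C ^+ mdeg e) /\
    F (p + x%:C *: v) = csum (fun e => c e * monomial e v * x%:C ^+ mdeg e).
  move=> xr; have [|s e] := hF (p + x%:C *: v).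
    move=> j; rewrite !mxE addrAC subrr add0r Normc.normcM normc_real.
    apply: (@le_lt_trans _ _ (`|x| * m)); first by rewrite ler_wpM2l.
    by rewrite -ltr_pdivlMr.
  have E : (fun e => c e * monomial e (p + x%:C *: v - p)) =
      (fun e => c e * monomial e v * x%:C ^+ mdeg e).
    by apply/funext => d; rewrite addrAC subrr add0r monomial_scale [_ * monomial _ _]mulrC mulrA.
  by rewrite E in s e.
pose b k := csum (fun e : mindex n => if mdeg e == k then c e * monomial e v else 0).
exists b, r'; split => // x xr; have [sx ->] := key x xr.
have E : (fun k => csum (fun e : mindex n => if mdeg e == k then c e * monomial e v * x%:C ^+ mdeg e else 0)) =
    (fun k => b k * x%:C ^+ k).
  apply/funext => k; pose y := r' / 2.
  have y0 : 0 < y by rewrite divr_gt0.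
  have [|sy _] := key y; first by rewrite gtr0_norm// /y; lra.
  have s1 : abs_summable (fun e : mindex n => if mdeg e == k then c e * monomial e v else 0).
    have := abs_summableZ (y%:C ^- k) sy.
    apply: abs_summable_dom => e; case: ifP => [/eqP <-|_]; last first.
      by rewrite Normc.normc0 normc_ge0.
    by rewrite [X in _ <= Normc.normc X]mulrC mulfK// expf_neq0// realC_neq0 gt_eqF.
  rewrite /b mulrC -csumZ//; congr csum; apply/funext => e; case: ifP => [/eqP <-|_].
    by rewrite mulrC.
  by rewrite mulr0.
rewrite -E; split; first exact: abs_summable_fiber.
by rewrite (csum_fiber (@mdeg n) sx).
Qed.

(** A tube contains every real point because [U] contains 0, so the line never leaves the domain of
    analyticity. *)
Lemma continuation_line (f : mindex n -> R[i]) F (x : 'rV[R]_n) : continuation f F ->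
  real_analytic (fun t => on_reals F (t *: x)).
Proof.
move=> [_ [U [_ U0 hU]]] t.
pose v : 'rV[R[i]]_n := \row_j (x 0 j)%:C.
pose p : 'rV[R[i]]_n := \row_j (t * x 0 j)%:C.
have [|c [r [r0 hc]]] := hU p.
  by rewrite /tube /=; congr (U _): U0; apply/rowP => j; rewrite !mxE.
have [b [r' [r'0 hb]]] := power_series_line v r0 hc.
exists b, r'; split => // s /hb[sb <-]; split => //.
rewrite /on_reals; congr F; apply/rowP => j; rewrite !mxE.
by rewrite -rmorphM -rmorphD; congr (_%:C); ring.
Qed.

(** Near t = 0 both functions equal the same series; the one-variable identity theorem carries the
    equality along t x up to t = 1. No identity theorem in several variables is involved. *)
Lemma continuation_unique (f : mindex n -> R[i]) F G (x : 'rV[R]_n) :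
  continuation f F -> continuation f G -> on_reals F x = on_reals G x.
Proof.
move=> hF hG; have hFG := real_analyticB (continuation_line x hF) (continuation_line x hG).
have [[r [r0 sF]] _] := hF; have [[r' [r'0 sG]] _] := hG.
pose m := \sum_j `|x 0 j| + 1.
have m0 : 0 < m by rewrite ltr_wpDl// sumr_ge0.
have xm j : `|x 0 j| <= m by rewrite /m (bigD1 j)//= -addrA lerDl addr_ge0// sumr_ge0.
have := @real_analytic_eq0 _ (Num.min r r' / m) hFG _ _ 1.
rewrite !scale1r => h; apply/eqP; rewrite -subr_eq0; apply/eqP; apply: h => //.
  by rewrite divr_gt0// lt_min r0.
move=> s; rewrite ltr_pdivlMr// lt_min => /andP[sr sr'].
have small (y : R) : `|s| * m < y -> polydisc 0 y (\row_j ((s *: x) 0 j)%:C).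
  move=> hy j; rewrite !mxE subr0 normc_real normrM; apply: le_lt_trans hy.
  by rewrite ler_wpM2l.
have [_ eF] := sF _ (small _ sr); have [_ eG] := sG _ (small _ sr').
by rewrite /on_reals eF eG subrr.
Qed.

End IdentityTheorem.

(** * The q-exponential and its continuation *)

Section QExponential.
Variables (R : realType) (P : R).
Hypotheses (P0 : 0 < P) (P1 : P < 1).
Local Notation normc := (@Normc.normc R).

Lemma expr_lt_eventually (e : R) : 0 < e ->
  exists N, forall k, (N <= k)%N -> P ^+ k < e.
Proof.
move=> e0; have /cvgrPdist_lt/(_ _ e0)[N _ h] : P ^+ k @[k --> \oo] --> (0 : R).
  by apply: cvg_expr; rewrite gtr0_norm.
exists N => k Nk; have := h k Nk.
by rewrite /= sub0r normrN ger0_norm// exprn_ge0// ltW.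
Qed.

Lemma qpochS (a : R) k : qpoch a P k.+1 = qpoch a P k * (1 - a * P ^+ k).
Proof. by rewrite /qpoch big_ord_recr. Qed.

Lemma qpoch_gt0 k : 0 < qpoch P P k.
Proof.
apply: prodr_gt0 => l _; rewrite subr_gt0 -exprS.
by rewrite exprn_ilt1 // ltW.
Qed.

Lemma eq_coefS k : eq_coef P k.+1 * (1 - P ^+ k.+1) = eq_coef P k.
Proof.
rewrite /eq_coef qpochS -exprS invfM mulfVK//.
by rewrite gt_eqF// subr_gt0 exprn_ilt1 // ltW.
Qed.

Lemma eq_coef_ge0 k : 0 <= eq_coef P k.
Proof. by rewrite invr_ge0 ltW// qpoch_gt0. Qed.

Definition qexp (w : R[i]) : R[i] := csum (fun k => (eq_coef P k)%:C * w ^+ k).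

(** Consecutive terms have ratio |w| / (1 - P^{k+1}), which tends to |w| < 1. *)
Lemma qexp_summable (w : R[i]) : normc w < 1 ->
  abs_summable (fun k => (eq_coef P k)%:C * w ^+ k).
Proof.
move=> w1; set y := normc w; have y0 : 0 <= y by exact: normc_ge0.
(* [x] is the midpoint of |w| and 1; once P^k < 1 - y/x, the ratio y / (1 - P^k) stays below [x]. *)
pose x := (1 + y) / 2; have x0 : 0 < x by rewrite /x; lra.
have x1 : x < 1 by rewrite /x -/y in w1 *; lra.
have yx : y < x by rewrite /x -/y in w1 *; lra.
have [|N hN] := @expr_lt_eventually (1 - y / x).
  by rewrite subr_gt0 ltr_pdivrMr// mul1r.
rewrite abs_summableE; apply: (@psummable_ratio _ _ N x) => [|k|k Nk].
- by rewrite x0.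
- exact: normc_ge0.
have hk : P ^+ k.+1 < 1 - y / x by apply: hN; exact: leqW.
rewrite !Normc.normcM !normcX !normc_real !ger0_norm ?eq_coef_ge0//.
rewrite -(eq_coefS k) exprS -/y mulrA [leRHS]mulrA ler_wpM2r ?exprn_ge0//.
rewrite [leRHS]mulrCA ler_wpM2l ?eq_coef_ge0// -ler_pdivrMl// mulrC.
by apply: ltW; rewrite ltrBrDr addrC -ltrBrDr.
Qed.

(** Coefficientwise, [eq_coefS] says e(w) - e(P w) = w e(w). *)
Lemma qexp_shift (w : R[i]) : normc w < 1 -> qexp (P%:C * w) = (1 - w) * qexp w.
Proof.
move=> w1; have sw := qexp_summable w1.
have sPw : abs_summable (fun k => (eq_coef P k)%:C * (P%:C * w) ^+ k).
  apply: qexp_summable; rewrite Normc.normcM normc_real gtr0_norm//.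
  by apply: le_lt_trans w1; rewrite ler_piMl ?normc_ge0// ltW.
suff E : qexp w + -1 * qexp (P%:C * w) = w * qexp w.
  by move: E; move: (qexp w) (qexp _) => x y E; rewrite mulrBl mul1r -E; ring.
rewrite -csumZ// -csumD//; last exact: abs_summableZ.
rewrite csum_recl; last by apply: abs_summableD => //; exact: abs_summableZ.
rewrite !expr0 !mulr1 mulN1r subrr add0r -csumZ//; congr csum; apply/funext => k /=.
rewrite mulN1r -(eq_coefS k) rmorphM rmorphB rmorph1 rmorphXn exprMn.
by rewrite [w ^+ k.+1]exprS; ring.
Qed.

Lemma qexp_near0 : exists2 M, 0 <= M & forall w, normc w <= 2^-1 ->
  normc (qexp w - 1) <= M * normc w.
Proof.
have h : 0 < 2^-1 :> R by rewrite invr_gt0.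
have [|M M0 hM] := csum_pseries_lip (b := fun k => (eq_coef P k)%:C) h.
  by apply: qexp_summable; rewrite normc_real gtr0_norm// invf_lt1// ltr1n.
exists M => // w /hM; congr (_ <= _); congr (normc (_ - _)).
by rewrite /eq_coef /qpoch big_ord0 invr1.
Qed.

Lemma qexp_real (x : R) : qexp x%:C = (rsum (fun k => eq_coef P k * x ^+ k))%:C.
Proof.
rewrite /qexp /csum; have E k : (eq_coef P k)%:C * x%:C ^+ k = (eq_coef P k * x ^+ k)%:C.
  by rewrite rmorphM rmorphXn.
under eq_fun do rewrite E; congr Complex => /=.
by under eq_fun do rewrite E; rewrite /= rsum0.
Qed.

(** Continuation of [qexp] by its functional equation; [N] is any number of steps that brings the
    argument into the unit disc, and [qexpcE] shows that the choice is immaterial. At a pole one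
    factor is the inverse of 0, hence 0; enlarging an admissible [N] only adds invertible
    factors. *)
Definition qexpc (w : R[i]) : R[i] :=
  let N := xget 0%N [set N | normc (P%:C ^+ N * w) < 1] in
  qexp (P%:C ^+ N * w) * \prod_(l < N) (1 - P%:C ^+ l * w)^-1.

Lemma normc_PX N (w : R[i]) : normc (P%:C ^+ N * w) = P ^+ N * normc w.
Proof. by rewrite Normc.normcM normcX normc_real gtr0_norm. Qed.

Lemma qexpc_step (w : R[i]) N m : normc (P%:C ^+ N * w) < 1 ->
  qexp (P%:C ^+ (N + m) * w) * \prod_(l < N + m) (1 - P%:C ^+ l * w)^-1 =
  qexp (P%:C ^+ N * w) * \prod_(l < N) (1 - P%:C ^+ l * w)^-1.
Proof.
move=> hN; elim: m => [|m IH]; first by rewrite addn0.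
have hm : normc (P%:C ^+ (N + m) * w) < 1.
  apply: le_lt_trans hN; rewrite !normc_PX; apply: ler_wpM2r (normc_ge0 w) _ _ _.
  rewrite exprD; apply: ler_piMr; first exact: exprn_ge0 (ltW P0).
  exact: exprn_ile1 (ltW P0) (ltW P1).
rewrite addnS exprS -mulrA (qexp_shift hm) big_ord_recr /= -IH.
have nz : 1 - P%:C ^+ (N + m) * w != 0.
  rewrite subr_eq0; apply: contraTneq hm => <-.
  by rewrite -[X in normc X]/(1%:C) normc_real normr1 ltxx.
by field.
Qed.

Lemma qexpcE (w : R[i]) N : normc (P%:C ^+ N * w) < 1 ->
  qexpc w = qexp (P%:C ^+ N * w) * \prod_(l < N) (1 - P%:C ^+ l * w)^-1.
Proof.
move=> hN; rewrite /qexpc; case: xgetP => [M _ hM|h]; last by case: (h N).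
have /orP[NM|MN] := leq_total N M.
  by rewrite -(subnKC NM); exact: qexpc_step.
by rewrite -(subnKC MN); apply/esym; exact: qexpc_step.
Qed.

Lemma qexpc_qexp (w : R[i]) : normc w < 1 -> qexpc w = qexp w.
Proof. by move=> w1; rewrite (@qexpcE w 0) ?expr0 ?mul1r// big_ord0 mulr1. Qed.

Lemma PX_eventually (x : R) : exists N, P ^+ N * x < 1.
Proof.
have h : 0 < `|x| + 1 by rewrite ltr_wpDl.
have [|N hN] := @expr_lt_eventually (`|x| + 1)^-1; first by rewrite invr_gt0.
exists N; have := hN N (leqnn N); rewrite -[X in _ < X -> _]mul1r ltr_pdivlMr//.
apply: le_lt_trans; rewrite ler_wpM2l ?exprn_ge0 ?(ltW P0)//.
by apply: le_trans (ler_norm x) _; rewrite lerDl.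
Qed.

Variable t : R.

Let factor_gt0 l : 0 < 1 - - t ^+ 2 * P ^+ l.
Proof. by rewrite mulNr opprK ltr_pwDl// mulr_ge0 ?sqr_ge0 ?exprn_ge0 ?(ltW P0). Qed.

Lemma qpoch_sqr_gt0 k : 0 < qpoch (- t ^+ 2) P k.
Proof. by apply: prodr_gt0 => l _; exact: factor_gt0. Qed.

Lemma qpoch_sqr_nondecr : {homo qpoch (- t ^+ 2) P : k m / (k <= m)%N >-> k <= m}.
Proof.
move=> k m /subnKC <-; elim: (m - k)%N => [|d IH]; first by rewrite addn0.
rewrite addnS qpochS; apply: le_trans IH _; rewrite ler_peMr ?(ltW (qpoch_sqr_gt0 _))//.
by rewrite mulNr opprK lerDl mulr_ge0 ?sqr_ge0 ?exprn_ge0 ?(ltW P0).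
Qed.

Lemma qpoch_sqr_qexpc N : P ^+ N * t ^+ 2 < 1 ->
  qexpc (- t ^+ 2)%:C * (qpoch (- t ^+ 2) P N)%:C = qexp (P ^+ N * - t ^+ 2)%:C.
Proof.
move=> hN; have hN' : normc (P%:C ^+ N * (- t ^+ 2)%:C) < 1.
  by rewrite normc_PX normc_real normrN ger0_norm ?sqr_ge0.
rewrite (qexpcE hN') rmorphM rmorphXn -mulrA; suff -> :
  \prod_(l < N) (1 - P%:C ^+ l * (- t ^+ 2)%:C)^-1 = ((qpoch (- t ^+ 2) P N)%:C)^-1.
  by rewrite mulVf ?mulr1// realC_neq0 gt_eqF// qpoch_sqr_gt0.
rewrite /qpoch rmorph_prod prodfV; congr (_^-1); apply: eq_bigr => l _.
by rewrite rmorphB rmorphM rmorphXn rmorph1 mulrC.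
Qed.

(** The product of qexpc(-t^2) with the k-th partial product equals qexp(-P^k t^2) for large k, and
    this tends to qexp(0) = 1. Convergence of the infinite product and its identification with the
    series come out together. *)
Lemma qpoch_sqr_cvg_qexpc : exists2 x : R, qexpc (- t ^+ 2)%:C = x%:C &
  x * qpoch (- t ^+ 2) P k @[k --> \oo] --> (1 : R).
Proof.
have [N hN] := PX_eventually (t ^+ 2).
pose r (y : R) := rsum (fun k => eq_coef P k * y ^+ k).
pose x := r (P ^+ N * - t ^+ 2) / qpoch (- t ^+ 2) P N.
have xE : qexpc (- t ^+ 2)%:C = x%:C.
  have := qpoch_sqr_qexpc hN; rewrite qexp_real -/(r _) => E.
  have nz : (qpoch (- t ^+ 2) P N)%:C != 0 :> R[i] by rewrite realC_neq0 gt_eqF ?qpoch_sqr_gt0.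
  by apply: (mulIf nz); rewrite E -rmorphM mulfVK// gt_eqF// qpoch_sqr_gt0.
exists x => //; have [M M0 hM] := qexp_near0.
(* 2^-1 is the radius in [qexp_near0]; e / (M + 1) turns its linear bound into one below e. *)
apply/cvgrPdist_lt => e e_gt0; pose d := Num.min (2^-1) (e / (M + 1)).
have M1 : 0 < M + 1 by rewrite ltr_wpDl.
have d0 : 0 < d by rewrite lt_min invr_gt0 ltr0n divr_gt0.
have t1 : 0 < t ^+ 2 + 1 by rewrite ltr_wpDl// sqr_ge0.
have [|K hK] := @expr_lt_eventually (d / (t ^+ 2 + 1)); first exact: divr_gt0.
exists K => // k /= Kk; have := hK k Kk; rewrite ltr_pdivlMr// => hk.
have Pk0 : 0 <= P ^+ k by rewrite exprn_ge0// ltW.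
have {}hk : P ^+ k * t ^+ 2 < d by apply: le_lt_trans hk; rewrite ler_wpM2l// lerDl.
have d2 : d <= 2^-1 by rewrite ge_min lexx.
have hk1 : P ^+ k * t ^+ 2 < 1.
  by apply: lt_le_trans hk _; apply: le_trans d2 _; rewrite invf_le1 ?ler1n.
have nk : normc (P ^+ k * - t ^+ 2)%:C = P ^+ k * t ^+ 2.
  by rewrite normc_real normrM normrN !ger0_norm ?sqr_ge0.
have := hM (P ^+ k * - t ^+ 2)%:C; rewrite nk => /(_ (le_trans (ltW hk) d2)).
rewrite -qpoch_sqr_qexpc// xE -rmorphM -(rmorph1 (real_complex R)) -rmorphB normc_real.
rewrite distrC => h; apply: le_lt_trans h _; apply: (@le_lt_trans _ _ ((M + 1) * (P ^+ k * t ^+ 2))).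
  by apply: ler_wpM2r; rewrite ?lerDl// mulr_ge0 ?sqr_ge0.
rewrite mulrC -ltr_pdivlMr//; apply: lt_le_trans hk _.
by rewrite ge_min lexx orbT.
Qed.

(** [qpoch_inf] is a [lim], so it means something only once convergence is known. The limit is 1/x,
    and x is not 0 since x times the partial products tends to 1. *)
Lemma qpoch_sqr_inf : qpoch (- t ^+ 2) P k @[k --> \oo] --> qpoch_inf (- t ^+ 2) P /\
  qexpc (- t ^+ 2)%:C = (eq_val P (- t ^+ 2))%:C.
Proof.
have [x xE xc] := qpoch_sqr_cvg_qexpc.
have x0 : x != 0.
  apply/eqP => x0; move: xc; rewrite x0; under eq_fun do rewrite mul0r.
  move=> /cvg_lim-/(_ (@Rhausdorff R)); rewrite lim_cst; last exact: Rhausdorff.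
  by move/eqP; rewrite eq_sym oner_eq0.
have c : qpoch (- t ^+ 2) P k @[k --> \oo] --> x^-1.
  rewrite -[x^-1]mulr1.
  have -> : (fun k => qpoch (- t ^+ 2) P k) = (fun k => x^-1 * (x * qpoch (- t ^+ 2) P k)).
    by apply/funext => k; rewrite mulKf.
  by apply: cvgM => //; exact: cvg_cst.
have e : qpoch_inf (- t ^+ 2) P = x^-1 by exact: cvg_lim c.
by rewrite /eq_val e invrK; split.
Qed.

Lemma qpoch_inf_ge k : qpoch (- t ^+ 2) P k <= qpoch_inf (- t ^+ 2) P.
Proof.
apply: nondecreasing_cvgn_le; first exact: qpoch_sqr_nondecr.
by apply/cvg_ex; exists (qpoch_inf (- t ^+ 2) P); case: qpoch_sqr_inf.
Qed.

Lemma eq_val_gt0 : 0 < eq_val P (- t ^+ 2).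
Proof. by rewrite invr_gt0; apply: lt_le_trans (qpoch_inf_ge 0); exact: qpoch_sqr_gt0. Qed.

Lemma eq_val_le k : eq_val P (- t ^+ 2) <= (qpoch (- t ^+ 2) P k)^-1.
Proof.
rewrite lef_pV2 ?posrE ?qpoch_sqr_gt0 ?qpoch_inf_ge//.
by rewrite -invr_gt0; exact: eq_val_gt0.
Qed.

(** Each of the first k factors satisfies 1 + t^2 P^l >= t^2 P^k, so the product is at least t^{2k}
    P^{k k}. Hence the weight decays faster than any power. *)
Lemma eq_val_decay k : eq_val P (- t ^+ 2) * (t ^+ 2) ^+ k <= (P ^+ (k * k))^-1.
Proof.
rewrite -[leRHS]div1r ler_pdivlMr ?exprn_gt0// -mulrA.
apply: le_trans (_ : (qpoch (- t ^+ 2) P k)^-1 * qpoch (- t ^+ 2) P k <= _); last first.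
  by rewrite mulVf// gt_eqF// qpoch_sqr_gt0.
apply: ler_pM; [exact: ltW eq_val_gt0| |exact: eq_val_le|].
  by apply: mulr_ge0; apply: exprn_ge0; [exact: sqr_ge0|exact: ltW].
rewrite exprM -exprMn /qpoch -[X in _ ^+ X]card_ord -prodr_const.
apply: ler_prod => l _; rewrite mulr_ge0 ?sqr_ge0 ?exprn_ge0 ?(ltW P0)//=.
rewrite mulNr opprK; apply: ler_wpDl => //.
by rewrite ler_wpM2l ?sqr_ge0// ler_wiXn2l ?(ltW P0) ?(ltW P1)// ltnW.
Qed.

End QExponential.

(** * The weight e_{q^4}(-z^2) on the strip |Im z| < 1 *)

Section Weight.
Variables (R : realType) (q : R).
Hypotheses (q0 : 0 < q) (q1 : q < 1).
Local Notation normc := (@Normc.normc R).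
Let P0 : 0 < q ^+ 4. Proof. exact: exprn_gt0. Qed.
Let P1 : q ^+ 4 < 1. Proof. by rewrite exprn_ilt1// ltW. Qed.

Definition weightc (z : R[i]) : R[i] := qexpc (q ^+ 4) (- z ^+ 2).
Definition weight (t : R) : R := eq_val (q ^+ 4) (- t ^+ 2).

Lemma weightc_real t : weightc t%:C = (weight t)%:C.
Proof.
have [_ <-] := qpoch_sqr_inf P0 P1 t.
by rewrite /weightc -rmorphXn -rmorphN.
Qed.

Lemma weightc_series :
  pseries_at (fun m => (subst_sq (-1) (eq_coef (q ^+ 4)) m)%:C) 0 1 weightc.
Proof.
move=> z; rewrite subr0 => z1.
have w1 : normc (- z ^+ 2) < 1.
  by rewrite normcN normcX exprn_ilt1// ?normc_ge0.
have [||s e] := csum_inj (f := double) (v := fun m => (subst_sq (-1) (eq_coef (q ^+ 4)) m)%:C * z ^+ m)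
    double_inj _ _ (qexp_summable P0 P1 w1).
- move=> k; rewrite /subst_sq odd_double doubleK -muln2 mulnC exprM rmorphM -mulrA.
  by rewrite [in RHS]exprNn rmorphXn rmorphN rmorph1.
- move=> m hm; rewrite /subst_sq; case: ifP => [_|/negbT mo]; first by rewrite mul0r.
  by have := hm m./2; rewrite -[X in _ != X]odd_double_half (negbTE mo) add0n eqxx.
by split; [exact: s|rewrite e /weightc (qexpc_qexp P0 P1 w1)].
Qed.

Let factor2 (i x z : R[i]) : i * i = -1 ->
  (1 - i * x * z) * (1 - - i * x * z) = 1 - x ^+ 2 * - z ^+ 2.
Proof.
move=> i2; transitivity (1 - (i * i) * (x ^+ 2 * z ^+ 2)); first by ring.
by rewrite i2; ring.
Qed.

(** Near [p] a fixed number N of functional equations writes the weight as its power series at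
    q^{2N} z times finitely many inverses 1 + q^{4l} z^2 = (1 - i q^{2l} z)(1 + i q^{2l} z), each
    linear factor being inverted by a geometric series. *)
Lemma weightc_analytic p : `|complex.Im p| < 1 -> analytic_at weightc p.
Proof.
(* Using |p| + 1 instead of |p| makes one [N] serve the whole unit disc around [p]. *)
move=> ip; have [N hN] := PX_eventually P0 P1 ((normc p + 1) ^+ 2).
have q4 l : (q ^+ 4)%:C ^+ l = ((q ^+ 2) ^+ l)%:C ^+ 2 :> R[i].
  by rewrite -!rmorphXn -!exprM; congr ((q ^+ _)%:C); rewrite mulnAC -mulnA mulnC.
have qN0 : 0 < (q ^+ 2) ^+ N by rewrite !exprn_gt0.
have qN (x : R) : 0 <= x -> (q ^+ 4) ^+ N * x ^+ 2 < 1 -> (q ^+ 2) ^+ N * x < 1.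
  move=> x0; rewrite -!exprM -[(4 * N)%N]/((2 * 2) * N)%N -mulnA mulnC exprM -exprMn.
  by rewrite expr_lt1 ?mulr_ge0// exprn_ge0// ltW.
pose g z := weightc (((q ^+ 2) ^+ N)%:C * z) *
  \prod_(l <- enum 'I_N) ((1 - ('i * ((q ^+ 2) ^+ l)%:C) * z)^-1 * (1 - (- 'i * ((q ^+ 2) ^+ l)%:C) * z)^-1).
apply: (@analytic_ext _ g _ _ 1) => //.
  move=> z zp; have zn : normc z <= normc p + 1.
    by rewrite -[z](subrK p) addrC (le_trans (le_normcD _ _))// lerD2l ltW.
  have hz : (q ^+ 4) ^+ N * normc z ^+ 2 < 1.
    apply: le_lt_trans hN; rewrite ler_wpM2l ?(ltW (exprn_gt0 _ P0))//.
    by rewrite lerXn2r// nnegrE ?normc_ge0// addr_ge0 ?normc_ge0.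
  rewrite /g {2}/weightc (@qexpcE _ _ P0 P1 _ N); last first.
    by rewrite (normc_PX P0) normcN normcX.
  rewrite /weightc -qexpc_qexp//; last first.
    by rewrite (normc_PX P0) normcN normcX.
  rewrite exprMn -q4 mulrN; congr (_ * _).
  rewrite big_enum; apply: eq_bigr => l _; rewrite -invfM q4; congr (_^-1).
  have i2 : 'i%C * 'i%C = -1 :> R[i] by rewrite -expr2 sqr_i.
  exact: factor2.
apply: analytic_mul.
  apply: analytic_scale; apply: (analytic_interior weightc_series).
  rewrite Normc.normcM normc_real gtr0_norm//.
  apply: le_lt_trans (qN _ _ hN); last by rewrite addr_ge0 ?normc_ge0.
  by rewrite ler_wpM2l ?(ltW qN0)// lerDl.
apply: analytic_prod; last first.
  by apply: (analytic_ext ltr01 _ (analytic_poly 1 p)) => z _; rewrite hornerC.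
(* The real part of 1 - s i x p is 1 + s x Im p, which is non-zero as x <= 1 and |Im p| < 1. *)
have nz (s : R) l : `|s| = 1 -> 1 - s%:C * 'i%C * ((q ^+ 2) ^+ l)%:C * p != 0.
  move=> s1; apply/eqP => /(congr1 (@complex.Re R)); case: (p) ip => a b ib.
  set x := (q ^+ 2) ^+ l; have -> : complex.Re (1 - s%:C * 'i%C * x%:C * (a +i* b)) = 1 + s * x * b.
    by rewrite /=; ring.
  rewrite /x /= => E.
  have : `|s * (q ^+ 2) ^+ l * b| < 1.
    rewrite !normrM s1 mul1r; apply: le_lt_trans ib; rewrite ler_piMl//.
    by rewrite ger0_norm ?exprn_ile1 ?exprn_ge0// ltW.
  have -> : s * (q ^+ 2) ^+ l * b = -1 by move: E; lra.
  by rewrite normrN normr1 ltxx.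
move=> l; apply: analytic_mul; apply: analytic_inv_linear.
  by have := nz 1 l (normr1 _); rewrite mul1r.
by have := nz (-1) l; rewrite normrN normr1 rmorphN mulN1r; apply.
Qed.

Lemma weight_gt0 t : 0 < weight t. Proof. exact: eq_val_gt0. Qed.

Lemma weight_le1 t : weight t <= 1.
Proof. by apply: le_trans (eq_val_le P0 P1 t 0) _; rewrite /qpoch big_ord0 invr1. Qed.

(** Since (q^2 t)^2 = q^4 t^2, the product for q^2 t is the product for t without its first
    factor. *)
Lemma weight_shift t : weight (q ^+ 2 * t) = (1 + t ^+ 2) * weight t.
Proof.
have t1 : 0 < 1 + t ^+ 2 by rewrite ltr_pwDl// sqr_ge0.
have [c _] := qpoch_sqr_inf P0 P1 (q ^+ 2 * t); have [c' _] := qpoch_sqr_inf P0 P1 t.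
suff E : qpoch_inf (- t ^+ 2) (q ^+ 4) = (1 + t ^+ 2) * qpoch_inf (- (q ^+ 2 * t) ^+ 2) (q ^+ 4).
  by rewrite /weight /eq_val E invfM mulVKf// gt_eqF.
rewrite -(cvg_shiftS (qpoch (- t ^+ 2) (q ^+ 4))) in c'.
have c2 : (1 + t ^+ 2) * qpoch (- (q ^+ 2 * t) ^+ 2) (q ^+ 4) k @[k --> \oo] -->
    (1 + t ^+ 2) * qpoch_inf (- (q ^+ 2 * t) ^+ 2) (q ^+ 4).
  by apply: cvgM => //; exact: cvg_cst.
have E : (fun k => qpoch (- t ^+ 2) (q ^+ 4) k.+1) =
    (fun k => (1 + t ^+ 2) * qpoch (- (q ^+ 2 * t) ^+ 2) (q ^+ 4) k).
  apply/funext => k; rewrite /qpoch big_ord_recl expr0 mulr1 opprK; congr (_ * _).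
  by apply: eq_bigr => i _; rewrite lift0 [_ ^+ i.+1]exprS; ring.
rewrite E in c'.
by rewrite -(cvg_lim (@Rhausdorff R) c2) (cvg_lim (@Rhausdorff R) c').
Qed.

End Weight.

(** * Jackson integrals *)

Section JacksonIntegral.
Variables (R : realType) (q : R).
Hypotheses (q0 : 0 < q) (q1 : q < 1).
Local Notation normc := (@Normc.normc R).
Implicit Types (c : R) (phi psi : R -> R[i]).

(** [jackson] adds the two signs inside the sum over k. One family over [int * bool] makes absolute
    summability, and with it linearity, directly available. *)
Definition jterm c phi (x : int * bool) : R[i] :=
  (q ^ (2 * x.1) * c)%:C * phi (sgnb R x.2 * q ^ (2 * x.1) * c).

Definition jintegrable c phi := abs_summable (jterm c phi).

Lemma jacksonE c phi : jintegrable c phi ->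
  jackson q c phi = (1 - q ^+ 2)%:C * csum (jterm c phi).
Proof.
move=> h; rewrite /jackson; congr (_ * _); rewrite -(csum_fiber fst h).
congr csum; apply/funext => k.
have [||_ ->] := @csum_seq _ _ [:: (k, true); (k, false)]
  (fun x : int * bool => if x.1 == k then jterm c phi x else 0).
- by rewrite /= !inE xpair_eqE eqxx.
- move=> [i b]; case: eqP => //= ->; rewrite !inE !xpair_eqE eqxx; by case: b.
by rewrite big_cons big_cons big_nil /= eqxx addr0 big_bool.
Qed.

Lemma jintegrableD c phi psi : jintegrable c phi -> jintegrable c psi ->
  jintegrable c (fun t => phi t + psi t).
Proof.
move=> hf hg; have := abs_summableD hf hg; congr abs_summable.
by apply/funext => x; rewrite /jterm mulrDr.
Qed.

Lemma jintegrableZ (a : R[i]) c phi : jintegrable c phi ->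
  jintegrable c (fun t => a * phi t).
Proof.
move=> hf; have := abs_summableZ a hf; congr abs_summable.
by apply/funext => x; rewrite /jterm mulrCA.
Qed.

Lemma jacksonD c phi psi : jintegrable c phi -> jintegrable c psi ->
  jackson q c (fun t => phi t + psi t) = jackson q c phi + jackson q c psi.
Proof.
move=> hf hg; rewrite !jacksonE//; last exact: jintegrableD.
rewrite -mulrDr -csumD//; congr (_ * csum _).
by apply/funext => x; rewrite /jterm mulrDr.
Qed.

Lemma jacksonZ (a : R[i]) c phi : jintegrable c phi ->
  jackson q c (fun t => a * phi t) = a * jackson q c phi.
Proof.
move=> hf; rewrite !jacksonE//; last exact: jintegrableZ.
rewrite [RHS]mulrCA; congr (_ * _); rewrite -csumZ//; congr csum.
by apply/funext => x; rewrite /jterm mulrCA.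
Qed.

Lemma jterm_scale (d c : R) phi : d != 0 ->
  jterm c (fun t => phi (d * t)) = fun x => d%:C^-1 * jterm (d * c) phi x.
Proof.
move=> d0; apply/funext => x; rewrite /jterm [RHS]mulrA; congr (_ * phi _); last by ring.
by rewrite [X in _^-1 * X%:C]mulrCA [(d * _)%:C]rmorphM mulKf// realC_neq0.
Qed.

Lemma jintegrable_scale (d c : R) phi : d != 0 -> jintegrable (d * c) phi ->
  jintegrable c (fun t => phi (d * t)).
Proof. by move=> d0 h; rewrite /jintegrable jterm_scale//; exact: abs_summableZ. Qed.

Lemma jackson_scale (d c : R) phi : d != 0 -> jintegrable (d * c) phi ->
  jackson q c (fun t => phi (d * t)) = d%:C^-1 * jackson q (d * c) phi.
Proof.
move=> d0 h; rewrite !jacksonE//; last exact: jintegrable_scale.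
by rewrite [RHS]mulrCA; congr (_ * _); rewrite -csumZ// jterm_scale.
Qed.

(** The parameters c and q^2 c define the same lattice with the same masses; only the index k moves
    by one. *)
Lemma jackson_shift c phi : jintegrable c phi ->
  jintegrable (q ^+ 2 * c) phi /\ jackson q (q ^+ 2 * c) phi = jackson q c phi.
Proof.
move=> h; pose f (x : int * bool) := (x.1 - 1, x.2).
have bf : bijective f.
  by exists (fun x => (x.1 + 1, x.2)) => -[k b]; rewrite /f /= ?subrK ?addrK.
have qn0 : q != 0 by rewrite gt_eqF.
have E : jterm (q ^+ 2 * c) phi \o f = jterm c phi.
  apply/funext => -[k b].
  transitivity ((q ^ (2 * (k - 1)) * (q ^+ 2 * c))%:C *
    phi (sgnb R b * q ^ (2 * (k - 1)) * (q ^+ 2 * c))); first by [].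
  have E : q ^ (2 * (k - 1)) * (q ^+ 2 * c) = q ^ (2 * k) * c.
    by rewrite mulrA -[q ^+ 2]/(q ^ 2) -expfzDr//; congr (q ^ _ * _); ring.
  by rewrite E -[sgnb R b * _ * _]mulrA E mulrA.
have [|s e] := csum_bij bf (v := jterm (q ^+ 2 * c) phi); first by rewrite E.
by split => //; rewrite !jacksonE// e E.
Qed.

Lemma abs_summable_int (x : R) : 0 <= x < 1 ->
  abs_summable (fun k : int => (x ^+ `|k|%N)%:C : R[i]).
Proof.
move=> hx; have sx : abs_summable (fun k => (x ^+ k)%:C : R[i]).
  rewrite abs_summableE; have := psummable_geometric hx; congr psummable.
  by apply/funext => k; rewrite normc_real ger0_norm// exprn_ge0//; case/andP: hx.
have [|||sp _] := csum_inj (f := Posz) (v := fun k => if k is Posz m then (x ^+ m)%:C else 0) _ _ _ sx => //.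
- by move=> i j [].
- by case=> // m /(_ m); rewrite eqxx.
have [|||sn _] := csum_inj (f := Negz) (v := fun k => if k is Negz m then (x ^+ m)%:C else 0) _ _ _ sx => //.
- by move=> i j [].
- by case=> // m /(_ m); rewrite eqxx.
(* [Negz m] stands for -(m + 1), hence the extra factor [x]. *)
have := abs_summableD sp (abs_summableZ x%:C sn); congr abs_summable.
by apply/funext => -[m|m] /=; rewrite ?mulr0 ?addr0 ?add0r// exprS rmorphM.
Qed.

(** The first bound controls the points near 0 (k >= 0), whose masses form a geometric series. The
    second controls the points near infinity, where |t| |phi(t)| <= M / |t|. The constant |c| +
    1/|c| covers both halves of the lattice. *)
Lemma jintegrable_bounded c phi (M : R) : c != 0 ->
  (forall t, t != 0 -> normc (phi t) <= M /\ normc (phi t) * t ^+ 2 <= M) ->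
  jintegrable c phi.
Proof.
move=> c0 h; have q2 : 0 <= q ^+ 2 < 1.
  by rewrite exprn_ge0 ?exprn_ilt1 ?(ltW q0).
have sb : abs_summable (fun _ : bool => 1 : R[i]).
  by have [//|[]//|] := @csum_seq R _ [:: true; false] (fun=> 1).
have := abs_summable_pair (abs_summable_int q2) sb.
move=> /(abs_summableZ (M * (`|c| + `|c|^-1))%:C).
have M0 : 0 <= M by apply: le_trans (proj1 (h 1 (oner_neq0 _))); exact: normc_ge0.
have c0' : 0 < `|c| by rewrite normr_gt0.
have d0 : 0 <= M * (`|c| + `|c|^-1) by rewrite mulr_ge0// addr_ge0// invr_ge0.
apply: abs_summable_dom => x; rewrite /jterm mulr1 !Normc.normcM !normc_real.
case: x => k b; rewrite -[(k, b).1]/k -[(k, b).2]/b.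
rewrite [`|_ * (_ + _)|]ger0_norm// [`|_ ^+ _ ^+ _|]ger0_norm; last first.
  by apply: exprn_ge0; case/andP: q2.
set t := sgnb R b * _ * c.
have qk0 : 0 < q ^ (2 * k) by rewrite exprz_gt0.
have tE : `|t| = q ^ (2 * k) * `|c|.
  by rewrite !normrM (gtr0_norm qk0); case: b @t => /= ; rewrite ?normrN normr1 mul1r.
have t0 : t != 0 by rewrite -normr_gt0 tE mulr_gt0.
have [h1 h2] := h t t0; rewrite normrM (gtr0_norm qk0).
have ci0 : 0 < `|c|^-1 by rewrite invr_gt0.
case: k @t tE t0 h1 h2 qk0 => m t tE t0 h1 h2 qk0.
  have -> : q ^ (2 * Posz m) = (q ^+ 2) ^+ m by rewrite -exprM -PoszM.
  rewrite -[leLHS]mulrA [leLHS]mulrC [`|c| * _]mulrC; apply: ler_wpM2r; first by rewrite exprn_ge0//; case/andP: q2.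
  by apply: ler_pM => //; [exact: normc_ge0|rewrite lerDl ltW].
rewrite -tE; have -> : (q ^+ 2) ^+ `|Negz m| = `|c| / `|t|.
  rewrite tE invfM mulrCA divff ?mulr1 ?gt_eqF// NegzE mulrN -PoszM.
  by rewrite -exprnN invrK -exprM abszN.
have t0' : 0 < `|t| by rewrite normr_gt0.
have -> : `|t| * normc (phi t) = (normc (phi t) * t ^+ 2) / `|t|.
  by rewrite -real_normK ?num_real// expr2 mulrA mulfK ?gt_eqF// mulrC.
apply: (@le_trans _ _ (M / `|t|)); first by rewrite ler_wpM2r// invr_ge0.
rewrite mulrA ler_wpM2r ?invr_ge0// -mulrA ler_peMr// mulrDl mulVf ?gt_eqF//.
by rewrite lerDr mulr_ge0.
Qed.

(** [eq_val_decay] bounds even powers only; for |t| > 1 the k-th power is estimated by the 2k-th,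
    and for |t| <= 1 the weight is at most 1. *)
Lemma jintegrable_monomial c m : c != 0 ->
  jintegrable c (fun t => (t ^+ m * weight q t)%:C).
Proof.
move=> c0; pose K k := ((q ^+ 4) ^+ (k * k))^-1 : R.
have P0 : 0 < q ^+ 4 by exact: exprn_gt0.
have P1 : q ^+ 4 < 1 by rewrite exprn_ilt1// ltW.
have K0 k : 0 <= K k by rewrite invr_ge0 exprn_ge0// ltW.
have decay k t : weight q t * `|t| ^+ (k * 2) <= K k.
  by rewrite mulnC exprM real_normK ?num_real//; exact: eq_val_decay.
have w0 t : 0 <= weight q t by exact: ltW (weight_gt0 q0 q1 t).
have bnd k t : weight q t * `|t| ^+ k <= 1 + K k.
  have [t1|t1] := leP `|t| 1.
    apply: (@le_trans _ _ 1); last by rewrite lerDl.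
    by rewrite mulr_ile1 ?exprn_ge0 ?weight_le1 ?exprn_ile1.
  apply: (@le_trans _ _ (K k)); last by rewrite lerDr.
  apply: le_trans (decay k t).
  by rewrite ler_wpM2l// ler_weXn2l ?(ltW t1)// leq_pmulr.
apply: (@jintegrable_bounded _ _ ((1 + K m) + (1 + K (m + 2)%N))) => // t t0.
rewrite normc_real normrM normrX (ger0_norm (w0 t)); split.
  by rewrite mulrC; apply: le_trans (bnd m t) _; rewrite lerDl addr_ge0.
rewrite -real_normK ?num_real// mulrAC -exprD mulrC.
by apply: le_trans (bnd _ t) _; rewrite lerDr addr_ge0.
Qed.

Lemma jintegrable_poly c (p : {poly R}) : c != 0 ->
  jintegrable c (fun t => (p.[t] * weight q t)%:C).
Proof.
move=> c0; have [s E] : exists s : seq nat, forall t, p.[t] = \sum_(i <- s) p`_i * t ^+ i.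
  by exists (index_iota 0 (size p)) => t; rewrite horner_coef big_mkord.
have -> : (fun t => (p.[t] * weight q t)%:C) =
    (fun t => \sum_(i <- s) (p`_i)%:C * (t ^+ i * weight q t)%:C).
  apply/funext => t; rewrite E mulr_suml rmorph_sum; apply: eq_bigr => i _.
  by rewrite -mulrA rmorphM.
elim: s {E} => [|i s IH].
  have -> : (fun t => \sum_(i <- [::]) (p`_i)%:C * (t ^+ i * weight q t)%:C) = fun=> 0.
    by apply/funext => t; rewrite big_nil.
  rewrite /jintegrable; have := abs_summable0 R (int * bool)%type; congr abs_summable.
  by apply/funext => x; rewrite /jterm mulr0.
have := jintegrableD (jintegrableZ (p`_i)%:C (jintegrable_monomial i c0)) IH.
by congr jintegrable; apply/funext => t; rewrite big_cons.
Qed.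

Definition jmoment c (p : {poly R}) : R[i] :=
  jackson q c (fun t => (p.[t] * weight q t)%:C).

Lemma jmomentD c p r : c != 0 -> jmoment c (p + r) = jmoment c p + jmoment c r.
Proof.
move=> c0; rewrite /jmoment -jacksonD; [|exact: jintegrable_poly..].
by congr jackson; apply/funext => t; rewrite hornerD mulrDl rmorphD.
Qed.

Lemma jmomentZ c a p : c != 0 -> jmoment c (a *: p) = a%:C * jmoment c p.
Proof.
move=> c0; rewrite /jmoment -jacksonZ; last exact: jintegrable_poly.
by congr jackson; apply/funext => t; rewrite hornerZ -mulrA rmorphM.
Qed.

Lemma jmoment_shift c p : c != 0 -> jmoment (q ^+ 2 * c) p = jmoment c p.
Proof. by move=> c0; case: (jackson_shift (jintegrable_poly p c0)). Qed.

(** The substitution t -> q^2 t multiplies the integral of t^m w by q^{-2} and preserves the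
    lattice, while the functional equation of w turns the integrand into q^{2m} (t^m + t^{m+2})
    w. *)
Lemma jmomentXSS c m : c != 0 ->
  jmoment c 'X^(m.+2) = ((q ^+ 2) ^- m.+1 - 1)%:C * jmoment c 'X^m.
Proof.
move=> c0; have q20 : q ^+ 2 != 0 by rewrite expf_neq0// gt_eqF.
have := jackson_scale q20 (jintegrable_poly 'X^m (mulf_neq0 q20 c0)).
rewrite -/(jmoment _ _) jmoment_shift//.
have -> : (fun t => (('X^m).[q ^+ 2 * t] * weight q (q ^+ 2 * t))%:C) =
    (fun t => ((((q ^+ 2) ^+ m) *: ('X^m + 'X^(m.+2))).[t] * weight q t)%:C).
  apply/funext => t; congr (_%:C); rewrite weight_shift// hornerZ hornerD !hornerXn.
  by rewrite exprMn !exprS; ring.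
rewrite -/(jmoment _ _) jmomentZ// jmomentD// => E.
have {}E : jmoment c 'X^m + jmoment c 'X^(m.+2) = ((q ^+ 2) ^- m.+1)%:C * jmoment c 'X^m.
  have nz : ((q ^+ 2) ^+ m)%:C != 0 :> R[i] by rewrite realC_neq0 expf_neq0.
  apply: (mulfI nz); rewrite E [RHS]mulrA -rmorphM -fmorphV; congr (_%:C * _).
  by rewrite [_ ^+ m.+1]exprS [in RHS]invfM [RHS]mulrCA divff ?mulr1// expf_neq0.
by rewrite rmorphB rmorph1 mulrBl mul1r -E addrAC subrr add0r.
Qed.

End JacksonIntegral.

(** * Discrete Hermite polynomials and their moments *)

Section Hermite.
Variables (R : realType) (q : R).
Hypotheses (q0 : 0 < q) (q1 : q < 1).
Local Notation p := (q ^+ 2).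
Local Notation pp := (qpoch (q ^+ 2) (q ^+ 2)).
Local Notation pp2 := (qpoch (q ^+ 4) (q ^+ 4)).

Let qn0 : q != 0. Proof. by rewrite gt_eqF. Qed.
Let pn0 : p != 0. Proof. by rewrite expf_neq0. Qed.
Let ppn0 k : pp k != 0.
Proof. by rewrite gt_eqF// qpoch_gt0 ?exprn_gt0 ?exprn_ilt1 ?(ltW q0). Qed.
Let pp2n0 k : pp2 k != 0.
Proof. by rewrite gt_eqF// qpoch_gt0 ?exprn_gt0 ?exprn_ilt1 ?(ltW q0). Qed.
Let ppS k : pp k.+1 = pp k * (1 - p ^+ k.+1).
Proof. by rewrite qpochS -exprS. Qed.
Let pp2S k : pp2 k.+1 = pp2 k * (1 - p ^+ (2 * k.+1)).
Proof. by rewrite qpochS -exprS -!exprM mulnA. Qed.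
Let p1n0 k : 1 - p ^+ k.+1 != 0.
Proof. by rewrite gt_eqF// subr_gt0 exprn_ilt1 ?exprn_ge0 ?exprn_ilt1 ?(ltW q0). Qed.

(** Extension by 0 beyond 2k <= l, so that the recurrence can be stated for all k despite truncated
    subtraction. *)
Definition hcoef l k : R := if (2 * k <= l)%N then
  pp l * ((-1) ^+ k * q ^ (- (4 * k * l)%:Z + (2 * k * (2 * k + 1))%:Z) /
    (pp2 k * pp (l - 2 * k))) else 0.

Lemma hermiteII_hcoef l N : (l./2 < N)%N ->
  hermiteII q l = \sum_(k < N) hcoef l k *: 'X^(l - 2 * k).
Proof.
move=> lN; rewrite /hermiteII scaler_sumr (big_ord_widen N (fun k => pp l *:
  (((-1) ^+ k * q ^ (- (4 * k * l)%:Z + (2 * k * (2 * k + 1))%:Z) /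
     (pp2 k * pp (l - 2 * k))) *: 'X^(l - 2 * k))) lN).
rewrite big_mkcond; apply: eq_bigr => k _; rewrite /hcoef ltnS.
have -> : (k <= l./2)%N = (2 * k <= l)%N by rewrite mul2n geq_half_double.
by case: ifP => _; rewrite ?scale0r// scalerA.
Qed.

Lemma hcoef_rec l k : hcoef l.+2 k.+1 =
  hcoef l.+1 k.+1 - p ^- (2 * l + 1) * (1 - p ^+ l.+1) * hcoef l k.
Proof.
rewrite /hcoef; have -> : (2 * k.+1 <= l.+2)%N = (2 * k <= l)%N by lia.
have [kl|kl] := leqP (2 * k) l; last first.
  by rewrite ifF ?mulr0 ?subr0//; apply/negbTE; rewrite -ltnNge; lia.
set Z := q ^ (- (4 * k.+1 * l.+2)%:Z + _).
have -> : q ^ (- (4 * k.+1 * l.+1)%:Z + (2 * k.+1 * (2 * k.+1 + 1))%:Z) = Z * p ^+ (2 * k.+1).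
  by rewrite -exprM exprnP -expfzDr//; congr (q ^ _); lia.
have -> : q ^ (- (4 * k * l)%:Z + (2 * k * (2 * k + 1))%:Z) = Z * p ^+ (2 * l + 1).
  by rewrite -exprM exprnP -expfzDr//; congr (q ^ _); lia.
have pl : p ^+ (2 * l + 1) != 0 by rewrite expf_neq0.
have -> : (l.+2 - 2 * k.+1 = l - 2 * k)%N by lia.
rewrite [pp l.+2]ppS [pp l.+1]ppS pp2S [(-1) ^+ k.+1]exprS.
have p2n0 : 1 - p ^+ (2 * k.+1) != 0 by rewrite mulnS; exact: p1n0.
have [kl1|kl1] := leqP (2 * k.+1) l.+1.
  have [d dE] : exists d, (l - 2 * k = d.+1)%N by exists (l - 2 * k).-1; lia.
  have -> : (l.+1 - 2 * k.+1 = d)%N by lia.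
  have -> : p ^+ l.+2 = p ^+ (2 * k.+1) * p ^+ d.+1 by rewrite -exprD; congr (_ ^+ _); lia.
  rewrite dE ppS; field.
  by rewrite !ppn0 pp2n0 p2n0 p1n0 pl.
(* Boundary case l = 2k: the coefficient of index k + 1 for l + 1 is out of range and contributes
   0. *)
have -> : (l - 2 * k = 0)%N by lia.
have -> : p ^+ l.+2 = p ^+ (2 * k.+1) by congr (_ ^+ _); lia.
by field; rewrite !ppn0 pp2n0 p2n0 pl.
Qed.

Lemma hcoef0 l : hcoef l 0 = 1.
Proof.
rewrite /hcoef muln0 leq0n subn0 !muln0 !mul0n oppr0 addr0 expr0z expr0 !mul1r.
by rewrite /qpoch big_ord0 mul1r divff// -/(pp l).
Qed.

Lemma hermiteII0 : hermiteII q 0 = 1.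
Proof. by rewrite (@hermiteII_hcoef 0 1)// big_ord1 hcoef0 scale1r. Qed.

Lemma hermiteII1 : hermiteII q 1 = 'X.
Proof. by rewrite (@hermiteII_hcoef 1 1)// big_ord1 hcoef0 scale1r. Qed.

Lemma hermiteII_rec l : hermiteII q l.+2 =
  'X * hermiteII q l.+1 - (p ^- (2 * l + 1) * (1 - p ^+ l.+1)) *: hermiteII q l.
Proof.
rewrite (@hermiteII_hcoef _ l.+3); last by lia.
rewrite (@hermiteII_hcoef l.+1 l.+3); last by lia.
rewrite (@hermiteII_hcoef l l.+2); last by lia.
rewrite big_ord_recl [X in 'X * X]big_ord_recl /= !hcoef0 !scale1r !muln0 !subn0.
rewrite mulrDr -exprS -addrA; congr (_ + _).
rewrite mulr_sumr scaler_sumr -sumrB; apply: eq_bigr => k _; rewrite /bump leq0n add1n hcoef_rec.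
have -> : (l.+2 - 2 * k.+1 = l - 2 * k)%N by lia.
rewrite scalerBl scalerA; congr (_ - _); rewrite -scalerAr -exprS /hcoef.
case: ifP => [kl|_]; last by rewrite !scale0r.
by congr (_ *: 'X^_); lia.
Qed.

(** Closed form for the integral of s^{a+2k} w h_a divided by the integral of w. The lemmas that
    follow check that it obeys the recurrences of the moments and of the Hermite polynomials. *)
Definition hmoment a k : R := p ^- ((a + k) ^ 2) * pp (a + 2 * k) / pp2 k.

Lemma hmoment_rec a k : hmoment a.+2 k =
  hmoment a.+1 k.+1 - p ^- (2 * a + 1) * (1 - p ^+ a.+1) * hmoment a k.+1.
Proof.
rewrite /hmoment.
have -> : (a.+1 + 2 * k.+1 = (a + 2 * k.+1).+1)%N by lia.
have -> : (a.+2 + 2 * k = a + 2 * k.+1)%N by lia.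
have -> : (a.+2 + k = a.+1 + k.+1)%N by lia.
have -> : p ^+ ((a.+1 + k.+1) ^ 2) = p ^+ ((a + k.+1) ^ 2) * p ^+ (2 * a + 1) * p ^+ (2 * k.+1).
  by rewrite -!exprD; congr (_ ^+ _); lia.
rewrite ppS pp2S.
have -> : p ^+ (a + 2 * k.+1).+1 = p ^+ a.+1 * p ^+ (2 * k.+1) by rewrite -exprD; congr (_ ^+ _); lia.
have p2n0 : 1 - p ^+ (2 * k.+1) != 0 by rewrite mulnS; exact: p1n0.
by field; rewrite !expf_neq0// pp2n0 p2n0.
Qed.

(** This is [hmoment_rec] at k = -1 with left side 0; it makes s^a integrate to 0 against w
    h_{a+2}. *)
Lemma hmoment_rec0 a : hmoment a.+1 0 = p ^- (2 * a + 1) * (1 - p ^+ a.+1) * hmoment a 0.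
Proof.
rewrite /hmoment !muln0 !addn0 ppS.
have -> : p ^+ (a.+1 ^ 2) = p ^+ (a ^ 2) * p ^+ (2 * a + 1).
  by rewrite -!exprD; congr (_ ^+ _); lia.
by field; rewrite !expf_neq0// pp2n0.
Qed.

Lemma hmoment0 k : hmoment 0 k.+1 = (p ^- (2 * k).+1 - 1) * hmoment 0 k.
Proof.
rewrite /hmoment !add0n pp2S mulnS !ppS.
have -> : p ^+ (k.+1 ^ 2) = p ^+ (k ^ 2) * p ^+ (2 * k).+1.
  by rewrite -!exprD; congr (_ ^+ _); lia.
by field; rewrite !expf_neq0// pp2n0 p1n0.
Qed.

Lemma hmoment1 k : hmoment 1 k = hmoment 0 k.+1.
Proof.
rewrite /hmoment !add0n add1n pp2S mulnS add1n [pp (2 * k).+2]ppS.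
by field; rewrite !expf_neq0// pp2n0 p1n0.
Qed.

Variable c : R.
Hypothesis c0 : c != 0.
Local Notation L := (jmoment q c).

(** Two-step induction on a. Both claims are proved together since the recurrence sends the exponent
    e to e + 1 for h_{a+1} and to e for h_a, which preserves the parity condition. *)
Lemma jmoment_hermite a :
  (forall k, L ('X^(a + 2 * k) * hermiteII q a) = (hmoment a k)%:C * L 1) /\
  (forall e, (e < a)%N -> odd e = odd a -> L ('X^e * hermiteII q a) = 0).
Proof.
have base k : L ('X^(2 * k)) = (hmoment 0 k)%:C * L 1.
  elim: k => [|k IH].
    by rewrite muln0 expr0 /hmoment /qpoch muln0 !big_ord0 !addn0 expr0 invr1 !mul1r.
  by rewrite mulnS jmomentXSS// IH hmoment0 [(_ * hmoment _ _)%:C]rmorphM -mulrA.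
elim/ltn_ind: a => -[|[|a]] IH.
- by split=> [k|//]; rewrite hermiteII0 mulr1 add0n base.
- split=> [k|[]//]; rewrite hermiteII1 -exprSr add1n hmoment1 -base.
  by congr (L 'X^_); lia.
have [IH1 IH1'] := IH a.+1 (ltnSn _); have [IH0 IH0'] := IH a (leqnSn _).
set g := p ^- (2 * a + 1) * (1 - p ^+ a.+1).
have rec e : L ('X^e * hermiteII q a.+2) =
    L ('X^(e.+1) * hermiteII q a.+1) - g%:C * L ('X^e * hermiteII q a).
  rewrite hermiteII_rec mulrBr mulrA -exprSr -(scalerAr g) -scaleNr.
  by rewrite jmomentD// jmomentZ// rmorphN mulNr.
split=> [k|e ea eo].
  have -> : (hmoment a.+2 k)%:C = (hmoment a.+1 k.+1)%:C - g%:C * (hmoment a k.+1)%:C :> R[i].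
    by rewrite -rmorphM -rmorphB hmoment_rec.
  rewrite rec mulrBl -[g%:C * _ * _]mulrA -IH1 -IH0.
  have -> : (a.+1 + 2 * k.+1 = (a.+2 + 2 * k).+1)%N by lia.
  by have -> : (a + 2 * k.+1 = a.+2 + 2 * k)%N by lia.
rewrite rec; have [ea1|ae] := ltnP e a.
  by rewrite IH1'// ?IH0' ?mulr0 ?subr0//=; move: eo => /= ->; rewrite ?negbK.
(* Below a + 2 and with the parity of a, the only exponent not under a is a itself; there the two
   terms cancel by [hmoment_rec0]. *)
have -> : e = a by move: ea ae eo; rewrite !ltnS leq_eqVlt => /orP[/eqP ->|] /=; [|]; lia.
have := IH1 0%N; have := IH0 0%N; rewrite muln0 !addn0 => -> ->.
have -> : (hmoment a.+1 0)%:C = g%:C * (hmoment a 0)%:C :> R[i].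
  by rewrite -rmorphM hmoment_rec0.
by rewrite -[g%:C * _ * _]mulrA subrr.
Qed.

End Hermite.

(** * Products of one-variable series in the q-commuting algebras *)

Section QProducts.
Variables (R : realType) (q : R) (n : nat).
Implicit Types (e d : mindex n) (i j : 'I_n).

(** Common form of [qmulA] and [qmulD]: [r] tells which pairs of variables cost a factor q when
    exchanged. [algA] and [algD] are the same type of coefficient families, so [monoA] and
    [uniseriesA] serve for both. *)
Definition qconv (r : rel nat) (f g : mindex n -> R[i]) : mindex n -> R[i] := fun e =>
  \sum_(d <- mbelow e) f d * g (msub e d) *
    (q ^+ (\sum_(i < n) \sum_(j < n | r i j) d i * msub e d j)%N)%:C.

Definition msingle i (m : nat) : mindex n := [ffun j => if j == i then m else 0%N].

Lemma msub_single e i m j : msub e (msingle i m) j = if j == i then (e i - m)%N else e j.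
Proof. by rewrite !ffunE; case: eqP => [->|_]//; rewrite subn0. Qed.

Variable r : rel nat.
Hypothesis rxx : forall i, r i i = false.

Lemma qconv_mono (f : mindex n -> R[i]) d e : qconv r f (monoA R d) e =
  if [forall i, (d i <= e i)%N] then f (msub e d) *
    (q ^+ (\sum_(i < n) \sum_(j < n | r i j) msub e d i * d j)%N)%:C else 0.
Proof.
have subK (a b : mindex n) : (forall i, (b i <= a i)%N) -> msub a (msub a b) = b.
  by move=> h; apply/ffunP => i; rewrite !ffunE subKn.
rewrite /qconv /monoA; case: ifP => [/forallP de|/forallP nde].
  have sd : msub e d \in mbelow e.
    by rewrite mem_mbelow; apply/forallP => i; rewrite ffunE leq_subr.
  rewrite (bigD1_seq (msub e d)) ?mbelow_uniq//= subK// eqxx mulr1.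
  rewrite [X in _ + X]big_seq_cond [X in _ + X]big1 ?addr0// => d'; rewrite mem_mbelow => /andP[/forallP h ne].
  case: eqP => [E|_]; last by rewrite mulr0 mul0r.
  by case/eqP: ne; rewrite -E subK.
rewrite big_seq big1// => d'; rewrite mem_mbelow => /forallP h.
case: eqP => [E|_]; last by rewrite mulr0 mul0r.
by case: nde => i; rewrite -E ffunE leq_subr.
Qed.

Lemma qconv_uni i (c : nat -> R) (g : mindex n -> R[i]) e :
  qconv r (uniseriesA i c) g e = \sum_(m < (e i).+1) (c m)%:C *
    g (msub e (msingle i m)) * (q ^+ (m * \sum_(j < n | r i j) e j)%N)%:C.
Proof.
pose F d := uniseriesA i c d * g (msub e d) *
    (q ^+ (\sum_(k < n) \sum_(j < n | r k j) d k * msub e d j)%N)%:C.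
have uni d : [forall j, (j != i) ==> (d j == 0%N)] = (d == msingle i (d i)).
  apply/forallP/eqP => [h|->] => [|j].
    apply/ffunP => j; rewrite ffunE; case: (eqVneq j i) => [->//|ji].
    by have := h j; rewrite ji => /eqP.
  by apply/implyP => /negbTE ji; rewrite ffunE ji.
transitivity (\sum_(d <- mbelow e | d == msingle i (d i)) F d).
  rewrite big_mkcond; apply: eq_bigr => d _; case: ifP => // /negbT.
  by rewrite /uniseriesA uni => /negbTE ->; rewrite !mul0r.
rewrite -big_filter (perm_big [seq msingle i m | m <- index_iota 0 (e i).+1]).
  rewrite big_map big_mkord; apply: eq_bigr => m _; rewrite /F /uniseriesA.
  have mi : msingle i m i = m by rewrite ffunE eqxx.
  rewrite uni mi eqxx; congr (_ * _ * (q ^+ _)%:C).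
  rewrite (bigD1 i)//= [X in (_ + X)%N]big1 ?addn0.
    rewrite big_distrr /=; apply: eq_bigr => j rij; rewrite mi msub_single.
    by case: eqP => // ji; rewrite ji rxx in rij.
  by move=> k /negbTE ki; rewrite big1// => j _; rewrite ffunE ki.
apply: uniq_perm.
- by rewrite filter_uniq// mbelow_uniq.
- rewrite map_inj_uniq ?iota_uniq// => m m' /(congr1 (fun d : mindex n => d i)).
  by rewrite !ffunE eqxx.
move=> d; rewrite mem_filter mem_mbelow; apply/andP/mapP => [[/eqP E /forallP h]|[m]].
  by exists (d i) => //; rewrite mem_index_iota /= ltnS.
rewrite mem_index_iota ltnS /= => mi ->; split; first by rewrite ffunE eqxx.
by apply/forallP => j; rewrite ffunE; case: eqP => [->|].
Qed.

Lemma qconv_uni_uni i (c c' : nat -> R) :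
  qconv r (uniseriesA i c) (uniseriesA i c') =
  uniseriesA i (fun m => \sum_(k < m.+1) c k * c' (m - k)%N).
Proof.
apply/funext => e; rewrite qconv_uni [RHS]/uniseriesA; case: ifP => [/forallP h|nh].
  have h0 j : j != i -> e j = 0%N by move=> ji; have := h j; rewrite ji => /eqP.
  rewrite rmorph_sum; apply: eq_bigr => m _; rewrite /uniseriesA ifT.
    rewrite msub_single eqxx big1 ?muln0 ?expr0 ?mulr1 ?rmorphM// => j rij.
    by apply: h0; apply: contraTneq rij => ->; rewrite rxx.
  by apply/forallP => j; apply/implyP => ji; rewrite msub_single (negbTE ji) h0.
rewrite big1// => m _; rewrite /uniseriesA ifF ?mulr0 ?mul0r//.
apply: contraFF nh => /forallP h; apply/forallP => j; apply/implyP => ji.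
by have := h j; rewrite ji msub_single (negbTE ji).
Qed.

Fixpoint qweight (s : seq 'I_n) e : nat :=
  if s is i :: s' then (e i * (\sum_(j < n | r i j && (j \in s')) e j) + qweight s' e)%N
  else 0%N.

Lemma eq_qweight s e d : {in s, e =1 d} -> qweight s e = qweight s d.
Proof.
elim: s => //= i s IH h; rewrite h ?mem_head//; congr (_ * _ + _)%N.
  by apply: eq_bigr => j /andP[_ js]; rewrite h// in_cons js orbT.
by apply: IH => j js; rewrite h// in_cons js orbT.
Qed.

Lemma big_qconv (c : 'I_n -> nat -> R) (s : seq 'I_n) : uniq s ->
  \big[qconv r/monoA R (mindex0 n)]_(j <- s) uniseriesA j (c j) = fun e =>
  if [forall j, (j \notin s) ==> (e j == 0%N)]
  then (\prod_(j <- s) c j (e j) * q ^+ qweight s e)%:C else 0.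
Proof.
elim: s => [_|i s IH /= /andP[nis us]].
  apply/funext => e; rewrite !big_nil /monoA /= mulr1.
  have -> : (e == mindex0 n) = [forall j, (j \notin [::]) ==> (e j == 0%N)].
    apply/eqP/forallP => [-> j|h]; first by rewrite ffunE.
    by apply/ffunP => j; have := h j; rewrite ffunE => /eqP.
  by case: ifP.
(* Later factors do not contain the variable i, so the first one has to take the full exponent
   [e i]: only the last summand survives. *)
apply/funext => e; rewrite [in LHS]big_cons IH// qconv_uni big_ord_recr /= big1 ?add0r.
  set e' := msub e _.
  have e's : {in s, e' =1 e}.
    by move=> j js; rewrite msub_single; case: eqP => // ji; rewrite -ji js in nis.
  have -> : [forall j, (j \notin s) ==> (e' j == 0%N)] =
      [forall j, (j \notin i :: s) ==> (e j == 0%N)].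
    apply: eq_forallb => j; rewrite in_cons negb_or msub_single.
    by case: (eqVneq j i) => [->|_]//=; rewrite subnn eqxx implybT.
  case: ifP => [/forallP h|_]; last by rewrite mulr0 mul0r.
  rewrite -!rmorphM /= big_cons exprD; congr (_%:C).
  rewrite (eq_qweight e's).
  have -> : \prod_(j <- s) c j (e' j) = \prod_(j <- s) c j (e j).
    by rewrite big_seq [RHS]big_seq; apply: eq_bigr => j js; rewrite e's.
  have -> : (\sum_(j < n | r i j) e j = \sum_(j < n | r i j && (j \in s)) e j)%N.
    rewrite big_mkcondr; apply: eq_bigr => j rij; case: ifP => // /negbT js.
    have := h j; rewrite in_cons negb_or js andbT.
    by case: eqP rij => [->|_ _ /eqP//]; rewrite rxx.
  by ring.
move=> m _; rewrite ifF ?mulr0 ?mul0r//; apply/negbTE/forallPn; exists i.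
by rewrite nis /= msub_single eqxx subn_eq0 -ltnNge.
Qed.

End QProducts.

Section OrderedProducts.
Variables (R : realType) (q : R) (n : nat).

Lemma index_enum_pairwise : pairwise (fun i j : 'I_n => (i < j)%N) (index_enum 'I_n).
Proof.
have -> : index_enum 'I_n = enum 'I_n by rewrite enumT.
rewrite -(pairwise_map val ltn) val_enum_ord -sorted_pairwise; last exact: ltn_trans.
exact: iota_ltn_sorted.
Qed.

Lemma qweight_gt (s : seq 'I_n) e : pairwise (fun i j : 'I_n => (i < j)%N) s ->
  qweight (fun i j => j < i)%N s e = 0%N.
Proof.
elim: s => //= i s IH /andP[/allP h /IH ->]; rewrite big1 ?muln0// => j /andP[ji /h].
by rewrite ltnNge (ltnW ji).
Qed.

Lemma qweight_lt (s : seq 'I_n) e : pairwise (fun i j : 'I_n => (i < j)%N) s ->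
  qweight (fun i j => i < j)%N s e =
  (\sum_(i <- s) e i * \sum_(j < n | (i < j)%N && (j \in s)) e j)%N.
Proof.
elim: s => [|i s IH] /=; first by rewrite big_nil.
move=> /andP[/allP h ps]; rewrite big_cons IH//; congr (_ * _ + _)%N.
  by apply: eq_bigl => j; rewrite in_cons; case: eqP => [->|//]; rewrite ltnn.
rewrite big_seq [RHS]big_seq; apply: eq_bigr => k ks; congr (_ * _)%N.
apply: eq_bigl => j; rewrite in_cons; case: eqP => [->|//] /=.
by rewrite ltnNge (ltnW (h k ks)).
Qed.

(** Increasing order is already the normal order of [algA], so no power of q appears. *)
Lemma big_qmulA (c : 'I_n -> nat -> R) :
  \big[@qmulA R q n/monoA R (mindex0 n)]_(j < n) uniseriesA j (c j) =
  fun e => (\prod_j c j (e j))%:C.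
Proof.
have := @big_qconv R q n (fun i j => j < i)%N (fun i => ltnn i) c (index_enum 'I_n) (index_enum_uniq _).
move=> E; apply/funext => e; move: (congr1 (fun f => f e) E) => /= {E} E.
apply: etrans E _; rewrite ifT; last first.
  by apply/forallP => j; rewrite mem_index_enum.
by rewrite qweight_gt ?index_enum_pairwise// expr0 mulr1.
Qed.

(** Normal order in [algD] puts d_n first, so increasing order is fully reversed and every pair i <
    j costs q^{e_i e_j}. *)
Lemma big_qmulD (c : 'I_n -> nat -> R) :
  \big[@qmulD R q n/monoD R (mindex0 n)]_(j < n) uniseriesD j (c j) =
  fun e => (\prod_j c j (e j) * q ^+ (\sum_i e i * \sum_(j < n | (i < j)%N) e j)%N)%:C.
Proof.
have := @big_qconv R q n (fun i j => i < j)%N (fun i => ltnn i) c (index_enum 'I_n) (index_enum_uniq _).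
move=> E; apply/funext => e; move: (congr1 (fun f => f e) E) => /= {E} E.
apply: etrans E _; rewrite ifT; last first.
  by apply/forallP => j; rewrite mem_index_enum.
rewrite qweight_lt ?index_enum_pairwise//; congr (_ * q ^+ _)%:C.
apply: eq_bigr => i _; congr (_ * _)%N; apply: eq_bigl => j.
by rewrite mem_index_enum andbT.
Qed.

Definition Hcoef (l m : nat) : R :=
  \sum_(k < m.+1) subst_sq (-1) (eq_coef (q ^+ 4)) k * (hermiteII q l)`_(m - k).

Lemma HseriesE (a : 'I_n -> nat) (e : mindex n) :
  Hseries q a e = (\prod_j Hcoef (a j) (e j))%:C.
Proof.
transitivity ((\big[@qmulA R q n/monoA R (mindex0 n)]_(j < n) uniseriesA j (Hcoef (a j))) e);
  last by rewrite big_qmulA.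
congr (_ e); apply: eq_bigr => j _.
exact: (@qconv_uni_uni R q n (fun i j => j < i)%N (fun i => ltnn i)).
Qed.

(** Coefficients of d^l E_{q^4}(-q^4 d^2). *)
Definition Ecoef (l m : nat) : R :=
  if (l <= m)%N then subst_sq (- q ^+ 4) (Eq_coef (q ^+ 4)) (m - l) else 0.

Lemma Eproduct (a : 'I_n -> nat) :
  \big[@qmulD R q n/monoD R (mindex0 n)]_(j < n)
    qmulD q (uniseriesD j (fun m => (m == a j)%:R))
            (uniseriesD j (subst_sq (- q ^+ 4) (Eq_coef (q ^+ 4)))) =
  fun e => (\prod_j Ecoef (a j) (e j) * q ^+ (\sum_i e i * \sum_(j < n | (i < j)%N) e j)%N)%:C.
Proof.
rewrite -(big_qmulD (fun j => Ecoef (a j))); apply: eq_bigr => j _.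
apply: etrans (@qconv_uni_uni R q n (fun i j => i < j)%N (fun i => ltnn i) j _ _) _.
congr uniseriesA; apply/funext => m; rewrite /Ecoef; case: ifP => am.
  rewrite (bigD1 (Ordinal (am : a j < m.+1)%N))//= eqxx mul1r big1 ?addr0// => k.
  by rewrite -val_eqE /= => /negbTE ->; rewrite mul0r.
rewrite big1// => k _; case: eqP => [E|_]; last by rewrite mul0r.
by have := ltn_ord k; rewrite E ltnS am.
Qed.

Lemma qmulA_mono_coef (f : algA R n) (b e : mindex n) : qmulA q f (monoA R b) e =
  if [forall i, (b i <= e i)%N] then f (msub e b) *
    (q ^+ (\sum_(i < n) (e i - b i) * \sum_(j < n | (j < i)%N) b j)%N)%:C else 0.
Proof.
apply: etrans (@qconv_mono R q n (fun i j => j < i)%N f b e) _; case: ifP => // _.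
congr (_ * (q ^+ _)%:C); apply: eq_bigr => i _; rewrite big_distrr /=.
by apply: eq_bigr => j _; rewrite ffunE.
Qed.

End OrderedProducts.

(** * The realization of H x^b and its integral *)

Section ProductFunctions.
Variables (R : realType) (q : R) (n : nat).
Local Notation normc := (@Normc.normc R).

Lemma continuation_prod (c : 'I_n -> nat -> R[i]) (f : 'I_n -> R[i] -> R[i]) :
  (forall j, pseries_at (c j) 0 1 (f j)) ->
  (forall j p, `|complex.Im p| < 1 -> analytic_at (f j) p) ->
  continuation (fun e : mindex n => \prod_j c j (e j)) (fun z => \prod_j f j (z 0 j)).
Proof.
move=> hs ha.
have key (d : 'I_n -> nat -> R[i]) (p : 'rV[R[i]]_n) r :
    (forall j, pseries_at (d j) (p 0 j) r (f j)) ->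
    power_series_at (fun e : mindex n => \prod_j d j (e j)) p r (fun z => \prod_j f j (z 0 j)).
  move=> hd z zr; have [s e] := csum_ffun (fun j => proj1 (hd j _ (zr j))).
  have E : (fun e : mindex n => (\prod_j d j (e j)) * monomial e (z - p)) =
      (fun e : mindex n => \prod_j (d j (e j) * (z 0 j - p 0 j) ^+ e j)).
    by apply/funext => d'; rewrite /monomial -big_split; apply: eq_bigr => j _; rewrite !mxE.
  rewrite E; split=> //; rewrite e; apply: eq_bigr => j _.
  by have [] := hd j _ (zr j).
split.
  by exists 1; split => //; apply: key => j; rewrite mxE.
(* The strip |Im| < 1 in every coordinate; taking the interior makes openness immediate. *)
exists ([set x : 'rV[R]_n | forall j, `|x 0 j| < 1]°); split.
- exact: open_interior.
- apply: filterS (nbhsx_ballx (0 : 'rV[R]_n) 1 ltr01) => x h j.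
  by case: h => _ /(_ 0 j); rewrite /ball /= mxE sub0r normrN.
move=> p /interior_subset pU.
have hp j : analytic_at (f j) (p 0 j) by apply: ha; have := pU j; rewrite mxE.
have [d hd] : exists d : 'I_n -> nat -> R[i], forall j, exists r, 0 < r /\ pseries_at (d j) (p 0 j) r (f j).
  by have [d] := choice hp; exists d.
have [r hr] := choice hd.
exists (fun e : mindex n => \prod_j d j (e j)), (\big[Num.min/1]_j r j); split.
  by apply: (big_ind (fun x => 0 < x)) => // [x y x0 y0|j _]; [rewrite lt_min x0|case: (hr j)].
apply: key => j; case: (hr j) => _; apply: pseries_sub.
by rewrite (bigD1 j)//= ge_min lexx.
Qed.

Lemma abs_jackson_integrable_prod (c : 'rV[R]_n) (f : 'I_n -> R -> R[i]) :
  (forall j, jintegrable q (c 0 j) (f j)) ->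
  abs_jackson_integrable q c (fun t => \prod_j f j (t 0 j)).
Proof.
move=> h; have [s _] := csum_ffun h; move: s; congr abs_summable.
apply/funext => ke; rewrite rmorph_prod -big_split /=; apply: eq_bigr => j _.
by rewrite /jterm mxE.
Qed.

End ProductFunctions.

(** The scalar [x] carries the induction: with the outer variable fixed at t, the value of the first
    factor is absorbed into it. *)
Lemma jacksonn_prod (R : realType) (q : R) (n : nat) (x : R[i]) (c : 'rV[R]_n)
    (f : 'I_n -> R -> R[i]) : (forall j, jintegrable q (c 0 j) (f j)) ->
  jacksonn q c (fun t => x * \prod_j f j (t 0 j)) = x * \prod_j jackson q (c 0 j) (f j).
Proof.
elim: n x c f => [|n IH] x c f h; first by rewrite /= !big_ord0.
have r1 (j : 'I_n) : lift ord0 j = rshift 1 j by apply: val_inj.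
have l1 : ord0 = lshift n (ord0 : 'I_1) by apply: val_inj.
rewrite big_ord_recl /=.
set g := fun t : R => jacksonn q (rsubmx (c : 'rV_(1 + n))) _.
have -> : g = fun t => (x * \prod_(j < n) jackson q (c 0 (lift ord0 j)) (f (lift ord0 j))) * f ord0 t.
  apply/funext => t; rewrite /g.
  have -> : (fun s : 'rV[R]_n => x * \prod_j f j ((row_mx t%:M s : 'rV_(1 + n)) 0 j)) =
      (fun s : 'rV[R]_n => (x * f ord0 t) * \prod_j f (lift ord0 j) (s 0 j)).
    apply/funext => s; rewrite big_ord_recl mulrA; congr (_ * f _ _ * _).
      by rewrite l1 row_mxEl mxE eqxx mulr1n.
    by apply: eq_bigr => j _; congr (f _ _); rewrite r1 row_mxEr.
  rewrite (IH _ _ (fun j => f (lift ord0 j))); last first.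
    by move=> j; rewrite mxE -r1; exact: h.
  rewrite mulrAC; congr (_ * _ * _); apply: eq_bigr => j _.
  by rewrite mxE -r1.
by rewrite jacksonZ; [rewrite -mulrA [X in _ * X]mulrC|exact: h].
Qed.

Section Factor.
Variables (R : realType) (q : R).
Hypotheses (q0 : 0 < q) (q1 : q < 1).
Local Notation normc := (@Normc.normc R).

Lemma hermiteII_parity l m : odd m != odd l -> (hermiteII q l)`_m = 0.
Proof.
move=> ml; rewrite (@hermiteII_hcoef _ _ _ l.+1); last by lia.
rewrite coef_sum big1// => k _; rewrite coefZ coefXn /hcoef.
case: eqP => [E|_]; last by rewrite mulr0.
by case: ifP => [kl|_]; [case/eqP: ml; rewrite E; lia|rewrite mul0r].
Qed.

Lemma Hcoef_parity l m : odd m != odd l -> Hcoef q l m = 0.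
Proof.
move=> ml; rewrite /Hcoef big1// => k _; rewrite /subst_sq.
case: ifP => [_|ko]; first by rewrite mul0r.
by rewrite hermiteII_parity ?mulr0// oddB -1?ltnS// ko addbF.
Qed.

Variables l b B : nat.

Definition factorc (z : R[i]) : R[i] := ('X^b : {poly R[i]}).[z] *
  (weightc q ((q ^+ B)%:C * z) * (map_poly (real_complex R) (hermiteII q l)).[(q ^+ B)%:C * z]).

Definition fcoef (m : nat) : R :=
  if (b <= m)%N then Hcoef q l (m - b) * q ^+ (B * (m - b)) else 0.

Lemma factorc_series : pseries_at (fun m => (fcoef m)%:C) 0 1 factorc.
Proof.
have h1 := pseries_mul (weightc_series q0 q1)
  (pseries_poly (map_poly (real_complex R) (hermiteII q l)) (r := 1)).
have h2 : pseries_at (fun m => (Hcoef q l m * q ^+ (B * m))%:C) 0 1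
    (fun z => weightc q ((q ^+ B)%:C * z) *
       (map_poly (real_complex R) (hermiteII q l)).[(q ^+ B)%:C * z]).
  move=> z; rewrite subr0 => z1; have [|s e] := h1 ((q ^+ B)%:C * z).
    rewrite subr0 Normc.normcM normc_real; apply: le_lt_trans z1.
    by rewrite ler_piMl ?normc_ge0// ger0_norm ?exprn_ile1 ?exprn_ge0// ltW.
  rewrite subr0 in s e.
  suff E : (fun k => (\sum_(i < k.+1) (subst_sq (-1) (eq_coef (q ^+ 4)) i)%:C *
        (map_poly (real_complex R) (hermiteII q l))`_(k - i)) * ((q ^+ B)%:C * z) ^+ k) =
      (fun k => (Hcoef q l k * q ^+ (B * k))%:C * z ^+ k) by rewrite -E.
  apply/funext => k; rewrite exprMn mulrA rmorphM exprM !rmorphXn; congr (_ * _ * _).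
  by rewrite /Hcoef rmorph_sum; apply: eq_bigr => i _; rewrite rmorphM coef_map.
have := pseries_mul (pseries_poly ('X^b : {poly R[i]}) (r := 1)) h2.
congr pseries_at; apply/funext => m; rewrite /fcoef; case: ifP => bm.
  rewrite (bigD1 (Ordinal (bm : b < m.+1)%N))//= coefXn eqxx mul1r big1 ?addr0// => k.
  by rewrite -val_eqE /= coefXn => /negbTE ->; rewrite mul0r.
rewrite big1// => k _; rewrite coefXn; case: eqP => [E|_]; last by rewrite mul0r.
by have := ltn_ord k; rewrite E ltnS bm.
Qed.

Lemma factorc_analytic p : `|complex.Im p| < 1 -> analytic_at factorc p.
Proof.
move=> ip; apply: analytic_mul; first exact: analytic_poly.
apply: (@analytic_scale _ _ (fun z => weightc q z * (map_poly (real_complex R) (hermiteII q l)).[z])).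
apply: analytic_mul; last exact: analytic_poly.
apply: weightc_analytic => //; case: p ip => x y /= iy.
rewrite mul0r addr0 normrM; apply: le_lt_trans iy.
by rewrite ler_piMl// ger0_norm ?exprn_ile1 ?exprn_ge0// ltW.
Qed.

(** Writing t^b = q^{-Bb} (q^B t)^b makes the integrand a function of q^B t alone. *)
Lemma factorc_real (t : R) : factorc t%:C = ((q ^+ (B * b))%:C)^-1 *
  (('X^b * hermiteII q l).[q ^+ B * t] * weight q (q ^+ B * t))%:C.
Proof.
rewrite /factorc -rmorphM weightc_real// horner_map hornerM !hornerXn -fmorphV.
rewrite -rmorphXn -!rmorphM; congr (_%:C); rewrite exprMn -exprM.
have : q ^+ (B * b) != 0 by rewrite expf_neq0// gt_eqF.
by move: (q ^+ (B * b)) => x x0 /=; field.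
Qed.

Let QB0 : q ^+ B != 0. Proof. by rewrite expf_neq0// gt_eqF. Qed.

Let phi t := (('X^b * hermiteII q l).[t] * weight q t)%:C : R[i].

Lemma factorc_jintegrable c : c != 0 -> jintegrable q c (fun t => factorc t%:C).
Proof.
move=> c0; have h := jintegrable_poly q0 q1 ('X^b * hermiteII q l) (mulf_neq0 QB0 c0).
have := jintegrableZ ((q ^+ (B * b))%:C)^-1 (jintegrable_scale QB0 h).
by congr jintegrable; apply/funext => t; rewrite factorc_real.
Qed.

(** In the exponent B (b + 1), the part B b comes from [factorc_real] and B from the substitution s
    = q^B t. *)
Lemma factorc_jackson c : c != 0 -> jackson q c (fun t => factorc t%:C) =
  (q ^+ (B * b.+1))%:C^-1 * jmoment q (q ^+ B * c) ('X^b * hermiteII q l).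
Proof.
move=> c0; have h := jintegrable_poly q0 q1 ('X^b * hermiteII q l) (mulf_neq0 QB0 c0).
have -> : (fun t => factorc t%:C) = (fun t => ((q ^+ (B * b))%:C)^-1 * phi (q ^+ B * t)).
  by apply/funext => t; rewrite factorc_real.
rewrite jacksonZ; last exact: jintegrable_scale.
rewrite jackson_scale// mulrA -invfM -rmorphM -exprD; congr ((q ^+ _)%:C^-1 * _); lia.
Qed.

End Factor.

Section Integral.
Variables (R : realType) (q : R) (n : nat) (a : 'I_n -> nat) (b : mindex n).
Hypotheses (q0 : 0 < q) (q1 : q < 1).
Local Notation Bsum j := (\sum_(i < n | (i < j)%N) b i)%N.

Lemma qmulA_Hseries e : qmulA q (Hseries q a) (monoA R b) e =
  (\prod_j fcoef q (a j) (b j) (Bsum j) (e j))%:C.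
Proof.
rewrite qmulA_mono_coef; case: ifP => [/forallP h|/forallPn[i /negbTE h]].
  rewrite HseriesE -rmorphM -prodrXr -big_split /=; congr (_%:C).
  by apply: eq_bigr => j _; rewrite /fcoef h ffunE mulnC.
by rewrite (bigD1 i)//= /fcoef h mul0r.
Qed.

(** The j-th series only has degrees of the parity of a_j + b_j, so [Pi0] keeps it whole or kills
    it; the second branch is the killed case. *)
Definition efactor j : R[i] -> R[i] :=
  if odd (a j) == odd (b j) then factorc q (a j) (b j) (Bsum j) else fun=> 0.

Definition ecoef j (m : nat) : R[i] :=
  if odd m then 0 else (fcoef q (a j) (b j) (Bsum j) m)%:C.

Lemma Pi0_Hseries e : Pi0 (qmulA q (Hseries q a) (monoA R b)) e = \prod_j ecoef j (e j).
Proof.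
rewrite /Pi0; case: ifP => [/forallP h|/forallPn[j]].
  rewrite qmulA_Hseries rmorph_prod; apply: eq_bigr => j _.
  by rewrite /ecoef (negbTE (h j)).
by rewrite negbK => ej; rewrite (bigD1 j)//= /ecoef ej mul0r.
Qed.

Lemma efactor_series j : pseries_at (ecoef j) 0 1 (efactor j).
Proof.
rewrite /efactor /ecoef; case: eqP => [ab|/eqP ab].
  have := factorc_series q0 q1 (a j) (b j) (Bsum j); congr pseries_at.
  apply/funext => m; case: ifP => // mo; rewrite /fcoef; case: ifP => // bm.
  by rewrite Hcoef_parity ?mul0r// oddB// mo -ab; case: odd.
have -> : (fun m => if odd m then 0 else (fcoef q (a j) (b j) (Bsum j) m)%:C) = fun=> 0.
  apply/funext => m; case: ifP => // mo; rewrite /fcoef; case: ifP => // bm.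
  by rewrite Hcoef_parity ?mul0r// oddB// mo eq_sym.
move=> z _; have -> : (fun k => 0 * (z - 0) ^+ k) = fun=> 0.
  by apply/funext => k; rewrite mul0r.
by split; [exact: abs_summable0|rewrite csum0].
Qed.

Lemma efactor_analytic j p : `|complex.Im p| < 1 -> analytic_at (efactor j) p.
Proof.
rewrite /efactor; case: ifP => _ h; first exact: factorc_analytic.
by apply: (analytic_ext ltr01 _ (analytic_poly 0 p)) => z _; rewrite horner0.
Qed.

Lemma efactor_jintegrable j c : c != 0 -> jintegrable q c (fun t => efactor j t%:C).
Proof.
rewrite /efactor; case: ifP => _ c0; first exact: factorc_jintegrable.
have := abs_summable0 R (int * bool)%type; congr abs_summable.
by apply/funext => x; rewrite /jterm mulr0.
Qed.

Lemma Hseries_continuation :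
  continuation (Pi0 (qmulA q (Hseries q a) (monoA R b))) (fun z => \prod_j efactor j (z 0 j)).
Proof.
rewrite (_ : Pi0 _ = fun e : mindex n => \prod_j ecoef j (e j)); last first.
  by apply/funext => e; exact: Pi0_Hseries.
apply: (@continuation_prod _ _ ecoef efactor) => j; first exact: efactor_series.
exact: efactor_analytic.
Qed.

Let on_reals_prod : on_reals (fun z : 'rV[R[i]]_n => \prod_j efactor j (z 0 j)) =
  fun t => \prod_j efactor j (t 0 j)%:C.
Proof. by apply/funext => t; apply: eq_bigr => j _; rewrite mxE. Qed.

Lemma Hseries_integrable : integrable' q (qmulA q (Hseries q a) (monoA R b)).
Proof.
exists (fun z => \prod_j efactor j (z 0 j)); split; first exact: Hseries_continuation.
move=> c c0; rewrite on_reals_prod.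
apply: (abs_jackson_integrable_prod (f := fun j t => efactor j t%:C)) => j.
exact: efactor_jintegrable.
Qed.

Lemma integral'_Hseries (gamma : 'rV[R]_n) : (forall j, gamma 0 j != 0) ->
  integral' q (qmulA q (Hseries q a) (monoA R b)) gamma =
  \prod_(j < n) jackson q (q ^+ (n - j.+1) * gamma 0 j) (fun t => efactor j t%:C).
Proof.
move=> g0; rewrite /integral'.
(* Only real points are integrated over, and there the continuation picked by [xget] agrees with the
   explicit product. *)
have -> : on_reals (xget (fun=> 0) [set F | continuation (Pi0 (qmulA q (Hseries q a) (monoA R b))) F]) =
    fun t => 1 * \prod_j efactor j (t 0 j)%:C.
  rewrite -[RHS]/((fun f t => 1 * f t) (fun t : 'rV[R]_n => \prod_j efactor j (t 0 j)%:C)) -on_reals_prod.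
  apply/funext => t; rewrite mul1r; case: xgetP => [F _ hF|/(_ _ Hseries_continuation)//].
  exact: continuation_unique hF Hseries_continuation.
rewrite (jacksonn_prod _ (f := fun j t => efactor j t%:C)) ?mul1r.
  by apply: eq_bigr => j _; rewrite mxE.
by move=> j; apply: efactor_jintegrable; rewrite mxE mulf_neq0// expf_neq0// gt_eqF.
Qed.

End Integral.

(** Expanding |E|^2 yields the squares and each product e_i e_j twice. One copy joins \sum_j (n-j)
    e_j, which equals the sum of all E_j because n - j indices lie above j; the other copy is the
    normal-ordering exponent of [algD]. *)
Lemma mdeg_exponent n (e : mindex n) :
  (mdeg e ^ 2 + mdeg e + \sum_(j < n) (n - j.+1) * e j =
   \sum_j (e j ^ 2 + e j) + \sum_(j < n) (\sum_(i < n | (i < j)%N) e i) * (e j).+1 +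
   \sum_(i < n) e i * \sum_(j < n | (i < j)%N) e j)%N.
Proof.
have E1 : (mdeg e ^ 2 = \sum_j e j ^ 2 + \sum_(j < n) (\sum_(i < n | (i < j)%N) e i) * e j +
    \sum_(i < n) e i * \sum_(j < n | (i < j)%N) e j)%N.
  rewrite -mulnn {1}/mdeg big_distrl -!big_split /=; apply: eq_bigr => i _.
  rewrite /mdeg (bigID (fun j : 'I_n => j < i)%N) /= (bigID (fun j : 'I_n => i < j)%N (fun j => ~~ (j < i)%N)) /=.
  have -> : (\sum_(j < n | ~~ (j < i) && (i < j)) e j = \sum_(j < n | i < j) e j)%N.
    by apply: eq_bigl => j; lia.
  rewrite [X in (_ + (_ + X))%N](big_pred1 i); last by move=> j; rewrite /= -val_eqE /=; lia.
  by rewrite -mulnn; move: (bigop _ _ _) (bigop _ _ _) => x y; nia.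
have E2 : (\sum_(j < n) \sum_(i < n | (i < j)%N) e i = \sum_(j < n) (n - j.+1) * e j)%N.
  rewrite (exchange_big_dep xpredT)//=; apply: eq_bigr => i _.
  rewrite sum_nat_const; congr (_ * _)%N.
  have := card_ord n; rewrite -(cardC [pred j : 'I_n | (i < j)%N]).
  (* With 0-based i, the indices not above i are the i + 1 elements of the image of ['I_(i.+1)]. *)
  have -> : #|[predC [pred j : 'I_n | (i < j)%N]]| = i.+1.
    have wi : injective (widen_ord (ltn_ord i)) by move=> x y /(congr1 val) /= /val_inj.
    rewrite -[RHS]card_ord -(fintype.card_image wi).
    apply: eq_card => j; apply/idP/fintype.imageP => [|[k _ ->]]; rewrite !inE -leqNgt; first move=> ji.
      by exists (Ordinal (ji : j < i.+1)%N) => //; apply: val_inj.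
    by rewrite -ltnS /= ltn_ord.
  move=> h; transitivity #|[pred j : 'I_n | (i < j)%N]|; first exact: eq_card.
  by move: h; move: #|_| => x; lia.
rewrite E1 -E2; under [X in _ = (_ + X + _)%N]eq_bigr do rewrite mulnS.
by rewrite !big_split /= /mdeg; ring.
Qed.

(** * Comparison of the coefficients of both sides *)

Section Main.
Variables (R : realType) (q : R).
Hypotheses (q0 : 0 < q) (q1 : q < 1).

Lemma jmoment_shiftn c m p : c != 0 -> jmoment q (q ^+ (2 * m) * c) p = jmoment q c p.
Proof.
move=> c0; elim: m => [|m IH]; first by rewrite muln0 mul1r.
have c1 : q ^+ (2 * m) * c != 0 by rewrite mulf_neq0// expf_neq0// gt_eqF.
by rewrite mulnS exprD -mulrA (jmoment_shift q0 q1 _ c1).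
Qed.

(** The theorem for one variable, coefficient by coefficient. With e = a + 2k, (p;p)_e cancels and
    (-i)^{2k} = (-1)^k provides the sign of (-q^4)^k in the series of E. *)
Lemma jmoment_hermite_coef c a e : c != 0 -> odd a = odd e ->
  jmoment q c ('X^e * hermiteII q a) *
    ((- 'i%C) ^+ e * (q ^+ (e ^ 2 + e) / qpoch (q ^+ 2) (q ^+ 2) e)%:C) =
  jmoment q c 1 * ((- 'i%C) ^+ a * (q ^ (a%:Z - a%:Z ^+ 2))%:C * (Ecoef q a e)%:C).
Proof.
move=> c0 ae; have [hm hm0] := jmoment_hermite q0 q1 c0 a; rewrite /Ecoef.
have [le|lt] := leqP a e; last by rewrite hm0// mul0r !mulr0.
pose k := ((e - a)./2)%N; have eE : e = (a + 2 * k)%N by rewrite /k; lia.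
rewrite eE hm addKn mul2n /subst_sq odd_double doubleK -mul2n.
have -> : (- 'i%C) ^+ (a + 2 * k) = (- 'i%C) ^+ a * ((-1) ^+ k)%:C :> R[i].
  by rewrite exprD exprM sqrrN sqr_i rmorphXn rmorphN rmorph1.
have qn0 : q != 0 by rewrite gt_eqF.
have alg (u1 u2 u3 u4 u5 x y : R[i]) : u1 * (u2 * u3) = u4 * u5 ->
    u1 * y * (x * u2 * u3) = y * (x * u4 * u5).
  by move=> E; transitivity (y * x * (u1 * (u2 * u3))); [ring|rewrite E; ring].
suff E : hmoment q a k * ((-1) ^+ k * (q ^+ ((a + 2 * k) ^ 2 + (a + 2 * k)) /
      qpoch (q ^+ 2) (q ^+ 2) (a + 2 * k))) =
    q ^ (a%:Z - a%:Z ^+ 2) * (Eq_coef (q ^+ 4) k * (- q ^+ 4) ^+ k).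
  have {}E : (hmoment q a k)%:C * (((-1) ^+ k)%:C * (q ^+ ((a + 2 * k) ^ 2 + (a + 2 * k)) /
      qpoch (q ^+ 2) (q ^+ 2) (a + 2 * k))%:C) =
      (q ^ (a%:Z - a%:Z ^+ 2))%:C * (Eq_coef (q ^+ 4) k * (- q ^+ 4) ^+ k)%:C :> R[i].
    by rewrite -!rmorphM E.
  exact: alg E.
rewrite /hmoment /Eq_coef.
have pp0 : qpoch (q ^+ 2) (q ^+ 2) (a + 2 * k) != 0.
  by rewrite gt_eqF// qpoch_gt0 ?exprn_gt0 ?exprn_ilt1 ?(ltW q0).
have pp20 : qpoch (q ^+ 4) (q ^+ 4) k != 0.
  by rewrite gt_eqF// qpoch_gt0 ?exprn_gt0 ?exprn_ilt1 ?(ltW q0).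
have -> : q ^ (a%:Z - a%:Z ^+ 2) = q ^+ a / q ^+ (a ^ 2).
  by rewrite expfzDr// -exprnP exprnN; congr (_ * q ^ _).
have -> : (- q ^+ 4) ^+ k = (-1) ^+ k * (q ^+ 4) ^+ k by rewrite [LHS]exprNn.
have C2 : ('C(k, 2) * 2 + k = k ^ 2)%N by rewrite bin2; have := odd_double_half (k * k.-1); case: (k) => [|k']; rewrite ?oddM /= ; lia.
(* This is (a+2k)^2 + (a+2k) = a - a^2 + 4 C(k,2) + 4k + 2 (a+k)^2 with a - a^2 written as a
   quotient of powers; the last summand cancels p^{-(a+k)^2} in [hmoment]. *)
have EX : q ^+ ((a + 2 * k) ^ 2 + (a + 2 * k)) =
    q ^+ a / q ^+ (a ^ 2) * ((q ^+ 4) ^+ 'C(k, 2) * (q ^+ 4) ^+ k) * (q ^+ 2) ^+ ((a + k) ^ 2).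
  have n0 : q ^+ (a ^ 2) != 0 by rewrite expf_neq0.
  apply: (mulfI n0); transitivity (q ^+ a * ((q ^+ 4) ^+ 'C(k, 2) * (q ^+ 4) ^+ k) *
    (q ^+ 2) ^+ ((a + k) ^ 2)); last by field.
  by rewrite -!exprM -!exprD; congr (q ^+ _); lia.
rewrite EX; field.
by rewrite pp0 pp20 !expf_neq0.
Qed.

End Main.

(** [FS] is a total function, so its value has the intended meaning only together with
    [transformable], which is therefore part of the conclusion. *)
Theorem mainTheorem2 (R : realType) (q : R) (n : nat) (a : 'I_n -> nat)
    (hq0 : 0 < q) (hq1 : q < 1) (hn : (1 <= n)%N) :
  transformable q (Hseries q a) /\
  forall gamma : 'rV[R]_n, (forall j, gamma 0 j != 0) ->
    let B (j : 'I_n) := (\sum_(i < n | (i < j)%N) odd (a i))%N in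
    FS q gamma (Hseries q a) =
    scaleD
      ((\prod_(j < n) jackson q (q ^+ (n - j.+1 + B j) * gamma 0 j)
                        (fun t => (eq_val (q ^+ 4) (- t ^+ 2))%:C)) *
       (- 'i%C) ^+ (\sum_k a k)%N *
       (q ^ (\sum_k ((a k)%:Z - (a k)%:Z ^+ 2)))%:C)
      (\big[@qmulD R q n/monoD R (mindex0 n)]_(j < n)
         qmulD q (uniseriesD j (fun m => (m == a j)%:R))
                (uniseriesD j (subst_sq (- q ^+ 4) (Eq_coef (q ^+ 4))))).
Proof.
split=> [e|gamma g0 B]; first exact: Hseries_integrable.
have qn0 : q != 0 by rewrite gt_eqF.
rewrite Eproduct; apply/funext => e; rewrite /FS /scaleD integral'_Hseries//.
(* If some parity differs, both coefficients are 0: [efactor] is the zero function there, and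
   [Ecoef] reads an odd coefficient of an even series or a degree below a_j. *)
have [/forallP par|/forallPn[j jn]] := boolP [forall j, odd (a j) == odd (e j)]; last first.
  have -> : \prod_(j < n) jackson q (q ^+ (n - j.+1) * gamma 0 j) (fun t => efactor q a e j t%:C) = 0.
    rewrite (bigD1 j)//= /efactor (negbTE jn) /jackson.
    rewrite (_ : (fun k : int => _) = fun=> 0) ?csum0 ?mulr0 ?mul0r//.
    by apply/funext => k; rewrite big1// => b _; rewrite mulr0.
  have -> : \prod_j Ecoef q (a j) (e j) = 0.
    rewrite (bigD1 j)//= /Ecoef; case: ifP => [aj|_]; last by rewrite mul0r.
    by rewrite /subst_sq oddB// addbC -negb_eqb jn mul0r.
  by rewrite !mul0r mulr0.
pose E (j : 'I_n) := (\sum_(i < n | (i < j)%N) e i)%N.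
pose c (j : 'I_n) := q ^+ (n - j.+1 + B j) * gamma 0 j.
have c0 j : c j != 0 by rewrite mulf_neq0// expf_neq0.
have jE (j : 'I_n) : jackson q (q ^+ (n - j.+1) * gamma 0 j) (fun t => efactor q a e j t%:C) =
    (q ^+ (E j * (e j).+1))%:C^-1 * jmoment q (c j) ('X^(e j) * hermiteII q (a j)).
  have gj : q ^+ (n - j.+1) * gamma 0 j != 0 by rewrite mulf_neq0// expf_neq0.
  rewrite /efactor (par j) (factorc_jackson hq0 hq1 _ _ _ gj); congr (_ * _).
  (* Since e_i and a_i have the same parity, E_j = 2m + B_j, and the lattice factor q^{2m} does not
     change the moment. *)
  pose m := (\sum_(i < n | (i < j)%N) (e i)./2)%N.
  rewrite -[RHS](@jmoment_shiftn _ _ hq0 hq1 (c j) m _ (c0 j)).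
  suff -> : q ^+ (\sum_(i < n | (i < j)%N) e i) * (q ^+ (n - j.+1) * gamma 0 j) =
      q ^+ (2 * m) * c j by [].
  have -> : (\sum_(i < n | (i < j)%N) e i = 2 * m + B j)%N.
    rewrite /B big_distrr -big_split /=; apply: eq_bigr => i _.
    by rewrite (eqP (par i)) mul2n addnC odd_double_half.
  by rewrite /c !exprD; move: (q ^+ (2 * m)) (q ^+ B j) => x y; ring.
rewrite (eq_bigr _ (fun j _ => jE j)).
have mE (j : 'I_n) : jackson q (q ^+ (n - j.+1 + B j) * gamma 0 j)
    (fun t => (eq_val (q ^+ 4) (- t ^+ 2))%:C) = jmoment q (c j) 1.
  by congr jackson; apply/funext => t; rewrite hornerC mul1r.
rewrite [X in _ = X * _ * _ * _](eq_bigr _ (fun j _ => mE j)).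
set S := (\sum_(i < n) e i * \sum_(j < n | (i < j)%N) e j)%N.
(* Once q^T has cancelled the factors from the substitutions, a product over single variables
   remains, and q^S matches the normal ordering on the right. *)
transitivity ((\prod_j (jmoment q (c j) ('X^(e j) * hermiteII q (a j)) *
    ((- 'i%C) ^+ e j * (q ^+ (e j ^ 2 + e j) / qpoch (q ^+ 2) (q ^+ 2) (e j))%:C))) * (q ^+ S)%:C).
  rewrite mdeg_exponent -/S; set A := (\sum_j (e j ^ 2 + e j))%N.
  set T := (\sum_(j < n) (\sum_(i < n | (i < j)%N) e i) * (e j).+1)%N.
  have alg (t u x y w z : R[i]) : t != 0 ->
      t^-1 * x * (y * (w * t * z * u)) = x * (y * (w * u)) * z by move=> t0; field.
  have Tn0 : (q ^+ T)%:C != 0 :> R[i] by rewrite realC_neq0 expf_neq0.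
  have -> : (q ^+ (A + T + S) / \prod_j qpoch (q ^+ 2) (q ^+ 2) (e j))%:C =
      (q ^+ A)%:C * (q ^+ T)%:C * (q ^+ S)%:C * (\prod_j qpoch (q ^+ 2) (q ^+ 2) (e j))%:C^-1 :> R[i].
    by rewrite !exprD -fmorphV -!rmorphM.
  rewrite big_split /= prodfV -rmorph_prod prodrXr -/T.
  rewrite [in RHS]big_split /= [X in _ = _ * X * _]big_split /= prodrXr -/(mdeg e).
  have -> : \prod_(j < n) (q ^+ (e j ^ 2 + e j) / qpoch (q ^+ 2) (q ^+ 2) (e j))%:C =
      (q ^+ A)%:C * (\prod_j qpoch (q ^+ 2) (q ^+ 2) (e j))%:C^-1 :> R[i].
    by rewrite -fmorphV -rmorphM -rmorph_prod big_split /= prodrXr prodfV.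
  exact: alg.
rewrite (eq_bigr _ (fun j _ => jmoment_hermite_coef hq0 hq1 (c0 j) (eqP (par j)))).
rewrite [in LHS]big_split /= [X in _ * X * _ = _]big_split /=.
rewrite [X in _ * (X * _) * _ = _]big_split /= prodrXr.
have -> : \prod_(j < n) (q ^ ((a j)%:Z - (a j)%:Z ^+ 2))%:C =
    (q ^ (\sum_k ((a k)%:Z - (a k)%:Z ^+ 2)))%:C :> R[i].
  rewrite -rmorph_prod; congr (_%:C).
  by rewrite (big_morph (fun z : int => q ^ z) (fun x y => expfzDr x y qn0) (expr0z q)).
by rewrite -rmorph_prod [in RHS]rmorphM /= -!mulrA.
Qed.
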